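(* Let $\lambda$ be a nonzero dominant integral weight of $\mathfrak g$ and let $i,j\in\mathbf I$ with $i\neq j$. Then the elements $\mathrm X_i,\mathrm X_j\in\mathbf U_{\mathrm R}^\lambda(\mathfrak g)$ satisfy the relation $$\sum_{r=0}^{1-a_{ij}}(-1)^r\begin{bmatrix}1-a_{ij}\\ r\end{bmatrix}_{q_i}\mathrm X_i^r\,\mathrm X_j\,\mathrm X_i^{1-a_{ij}-r}=0.$$
   Context: **Lie data.** $\mathfrak g$ is a complex simple Lie algebra with Cartan subalgebra $\mathfrak h$, simple roots $\{\alpha_i\}_{i\in\mathbf I}$ and invariant non-degenerate symmetric bilinear form $(\cdot,\cdot)$ normalized so that short simple roots have square length $2$; $d_i=(\alpha_i,\alpha_i)/2$, $a_{ij}=(\alpha_i,\alpha_j)/d_i$ (Cartan matrix), $q_i=q^{d_i}$. $\mathsf Q=\bigoplus_i\mathbb Z\alpha_i$ is the root lattice, $\mathsf Q_+=\bigoplus_i\mathbb Z_{\ge0}\alpha_i$, $\mathsf Q_-=-\mathsf Q_+$, and $\mathsf Q_+^\beta=\{\nu\in\mathsf Q_+:\beta-\nu\in\mathsf Q_+\}$. $\begin{bmatrix}n\\ r\end{bmatrix}_q=\frac{[n]_q!}{[r]_q![n-r]_q!}$ with $[m]_q=\frac{q^m-q^{-m}}{q-q^{-1}}$. **Quantum group.** $U_q(\mathfrak g)$ is the unital associative $\mathbb Q(q)$-algebra generated by $E_i,F_i$ ($i\in\mathbf I$), $K_\mu^{\pm1}$ ($\mu\in\mathsf Q$) with relations $K_\mu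 K_\gamma=K_{\mu+\gamma}$, $K_0=1$, $K_\mu E_jK_\mu^{-1}=q^{(\mu,\alpha_j)}E_j$, $K_\mu F_jK_\mu^{-1}=q^{-(\mu,\alpha_j)}F_j$, $[E_i,F_j]=\delta_{ij}\frac{K_{\alpha_i}-K_{-\alpha_i}}{q_i-q_i^{-1}}$, and for $i\neq j$ the $q$-Serre relations $\sum_{b=0}^{1-a_{ij}}(-1)^b\begin{bmatrix}1-a_{ij}\\ b\end{bmatrix}_{q_i}Z_i^bZ_jZ_i^{1-a_{ij}-b}=0$ for $Z=E$ and $Z=F$. With $K_i=K_{\alpha_i}$ its coproduct is $\Delta(K_\mu)=K_\mu\otimes K_\mu$, $\Delta(E_i)=E_i\otimes K_i+1\otimes E_i$, $\Delta(F_i)=F_i\otimes1+K_i^{-1}\otimes F_i$. It is $\mathsf Q$-graded: the degree $\beta$ part is $\{x:K_\mu xK_\mu^{-1}=q^{(\beta,\mu)}x\ \forall\mu\in\mathsf Q\}$. $U_q(\mathfrak n^+)$, $U_q(\mathfrak n^-)$ are the subalgebras generated by the $E_i$, resp. $F_i$; $U_q(\mathfrak b^\pm)$ is generated by $U_q(\mathfrak n^\pm)$ and the $K_\beta$. **The module $V$.** $V$ is the finite-dimensional irreducible type $1$ $U_q(\mathfrak g)$-module of highest weight $\lambda$, $\pi:U_q(\mathfrak g)\to\mathrm{End}(V)$ its action, $V=\bigoplus_\mu V_\mu$ with $V_\mu=\{w:K_\beta w=q^{(\mu,\beta)}w\ \forall\beta\in\mathsf Q\}$, $\mathsf\Lambda_\lambda=\{\mu:V_\mu\ne0\}$.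 $\mathrm{End}(V)_\beta=\{X:X(V_\mu)\subset V_{\mu+\beta}\ \forall\mu\}$. For $T\in\mathrm{End}(V)\otimes\mathscr U$, $T_\beta$ is its component in $\mathrm{End}(V)_\beta\otimes\mathscr U$, and $T_1,T_2\in\mathrm{End}(V)^{\otimes2}\otimes\mathscr U$ denote $T$ placed in the first/second $\mathrm{End}(V)$-factor. **The $R$-matrix.** $\Psi$ is the automorphism of $U_q(\mathfrak g)^{\otimes2}$ fixing $K_i\otimes1$, $1\otimes K_i$, with $E_i\otimes1\mapsto E_i\otimes K_i^{-1}$, $F_i\otimes1\mapsto F_i\otimes K_i$, $1\otimes E_i\mapsto K_i^{-1}\otimes E_i$, $1\otimes F_i\mapsto K_i\otimes F_i$; $\Delta_\Psi=\Psi\circ\Delta$. $\{\mathscr R_\nu^+\}_{\nu\in\mathsf Q_+}$ is the unique family with $\mathscr R^+_\nu\in U_q(\mathfrak n^+)_\nu\otimes U_q(\mathfrak n^-)_{-\nu}$, $\mathscr R_0^+=1$ and, for all $\beta\in\mathsf Q_+$, $x\in U_q(\mathfrak b^+)$, $y\in U_q(\mathfrak b^-)$, $\sum_{\nu\in\mathsf Q_+^\beta}(\mathscr R_\nu^+\Delta(x)_{\beta-\nu}-\Delta_\Psi^{\mathrm{op}}(x)_{\beta-\nu}\mathscr R_\nu^+)=0=\sum_{\nu\in\mathsf Q_+^\beta}(\mathscr R_\nu^+\Delta(y)^{\nu-\beta}-\Delta_\Psi^{\mathrm{op}}(y)^{\nu-\beta}\mathscr R_\nu^+)$, where $u_\gamma$,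 $u^\gamma$ are the components of $u$ whose first, resp. second, tensor leg has degree $\gamma$. $\mathscr R^+=\sum_\nu\mathscr R^+_\nu$ (only finitely many terms act nontrivially on a finite-dimensional module). $\mathscr D=\sum_{\mu,\gamma\in\mathsf\Lambda_\lambda}q^{(\mu,\gamma)-(\lambda,\lambda)}\mathrm{Id}_{V_\mu\otimes V_\gamma}$ and $\mathrm R=\mathscr D\cdot(\pi\otimes\pi)(\mathscr R^+)\in\mathrm{End}(V\otimes V)$. **The algebra $\mathbf U_{\mathrm R}^\lambda(\mathfrak g)$.** It is the unital associative $\mathbb Q(q)$-algebra generated by the coefficients of two matrices $\mathrm L^\pm\in\bigoplus_{\beta\in\mathsf Q_\pm}\mathrm{End}(V)_\beta\otimes\mathbf U_{\mathrm R}^\lambda(\mathfrak g)$ (that is, $\mathrm L^\pm=\sum_kX_k^\pm\otimes l_k^\pm$ with $\{X_k^\pm\}$ a basis of $\bigoplus_{\beta\in\mathsf Q_\pm}\mathrm{End}(V)_\beta$ and the $l_k^\pm$ the generators), subject to $\mathscr L^+\mathscr L^-=I=\mathscr L^-\mathscr L^+$ where $\mathscr L^\pm:=\mathrm L^\pm_0$, and $\mathrm R\mathrm L_1^+\mathrm L_2^-=\mathrm L_2^-\mathrm L_1^+\mathrm R$, $\mathrm R\mathrm L_1^\pm\mathrm L_2^\pm=\mathrm L_2^\pm\mathrm L_1^\pm\mathrm R$. For $i\in\mathbf I$, $\mathrm X_i\in\mathbf U_{\mathrm R}^\lambda(\mathfrak g)$ is the (unique) element with $((\mathscr L^+)^{-1}\mathrm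 L^+)_{\alpha_i}=\pi(E_i)\otimes\mathrm X_i$. *)

(* Defs.v *)
From HB Require Import structures.
From mathcomp Require Import all_boot all_order all_algebra.
From mathcomp Require Import boolp classical_sets functions
  cardinality fsbigop.
From mathcomp Require Import fraction mxtens.
From mathcomp.multinomials Require Import monalg.

Set Implicit Arguments.
Unset Strict Implicit.
Unset Printing Implicit Defensive.

Import Order.TTheory GRing.Theory Num.Theory.

Local Open Scope classical_set_scope.
Local Open Scope quotient_scope.
Local Open Scope ring_scope.

(* ------------------------------------------------------------------------ *)
(* Algebras given by generators and relations.                              *)

Lemma malg_scalerAr (M : monomType) (K : fieldType) (c : K) (x y : {malg K[M]}) :
  c *: (x * y) = x * (c *: y).
Proof.
apply/malgP => k; rewrite mcoeffZ (mcoeffMl x y k).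
rewrite (mcoeffMlw k (finmap.fsubset_refl (msupp x)) (msuppZ_le c y)).
rewrite mulr_sumr; apply: eq_bigr => k1 _.
rewrite mulr_sumr; apply: eq_bigr => k2 _.
by rewrite mcoeffZ mulrnAr mulrCA.
Qed.

Section FreeAlgebra.
Variables (K : fieldType) (G : choiceType).

Local Notation M := {malg K[{fmonom G}]}.

(* The monoid algebra of the free monoid on G. Its operations are locked because
   unification would otherwise unfold them, at great cost. *)
Definition free_alg := M.
HB.instance Definition _ := Choice.on free_alg.

Implicit Types x y z : free_alg.

Definition free_zero : free_alg := locked (0 : M).
Definition free_one : free_alg := locked (1 : M).
Definition free_opp x : free_alg := locked (@GRing.opp M) x.
Definition free_add x y : free_alg := locked (@GRing.add M) x y.
Definition free_mul x y : free_alg := locked (@GRing.mul M) x y.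
Definition free_scale (c : K) x : free_alg := locked (@GRing.scale K M) c x.
Definition free_gen (s : G) : free_alg := locked (mkmalgU (fmu s) (1 : K)).

Lemma free_addA : associative free_add.
Proof. by rewrite /free_add -lock; exact: addrA. Qed.
Lemma free_addC : commutative free_add.
Proof. by rewrite /free_add -lock; exact: addrC. Qed.
Lemma free_add0 : left_id free_zero free_add.
Proof. by rewrite /free_add /free_zero -!lock; exact: add0r. Qed.
Lemma free_addN : left_inverse free_zero free_opp free_add.
Proof. by rewrite /free_add /free_zero /free_opp -!lock; exact: addNr. Qed.

HB.instance Definition _ :=
  GRing.isZmodule.Build free_alg free_addA free_addC free_add0 free_addN.

Lemma free_mulA : associative free_mul.
Proof. by rewrite /free_mul -lock; exact: mulrA. Qed.
Lemma free_mul1l : left_id free_one free_mul.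
Proof. by rewrite /free_mul /free_one -!lock; exact: mul1r. Qed.
Lemma free_mul1r : right_id free_one free_mul.
Proof. by rewrite /free_mul /free_one -!lock; exact: mulr1. Qed.
Lemma free_mulDl : left_distributive free_mul free_add.
Proof. by rewrite /free_mul /free_add -!lock; exact: mulrDl. Qed.
Lemma free_mulDr : right_distributive free_mul free_add.
Proof. by rewrite /free_mul /free_add -!lock; exact: mulrDr. Qed.
Lemma free_1neq0 : free_one != free_zero.
Proof. by rewrite /free_one /free_zero -!lock; exact: oner_neq0. Qed.

HB.instance Definition _ := GRing.Zmodule_isNzRing.Build free_alg
  free_mulA free_mul1l free_mul1r free_mulDl free_mulDr free_1neq0.

Lemma free_scaleA a b x : free_scale a (free_scale b x) = free_scale (a * b) x.
Proof. by rewrite /free_scale -lock; exact: scalerA. Qed.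
Lemma free_scale1 : left_id 1 free_scale.
Proof. by rewrite /free_scale -lock; exact: scale1r. Qed.
Lemma free_scaleDr : right_distributive free_scale free_add.
Proof. by rewrite /free_scale /free_add -!lock; exact: scalerDr. Qed.
Lemma free_scaleDl x : {morph free_scale^~ x : a b / a + b >-> free_add a b}.
Proof. by rewrite /free_scale /free_add -!lock; exact: scalerDl. Qed.

HB.instance Definition _ := GRing.Zmodule_isLmodule.Build K free_alg
  free_scaleA free_scale1 free_scaleDr free_scaleDl.

Lemma free_scaleAl a x y : free_scale a (free_mul x y) = free_mul (free_scale a x) y.
Proof. by rewrite /free_scale /free_mul -!lock; exact: scalerAl. Qed.
Lemma free_scaleAr a x y : free_scale a (free_mul x y) = free_mul x (free_scale a y).
Proof. by rewrite /free_scale /free_mul -!lock; exact: malg_scalerAr. Qed.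

HB.instance Definition _ := GRing.Lmodule_isLalgebra.Build K free_alg free_scaleAl.
HB.instance Definition _ := GRing.Lalgebra_isAlgebra.Build K free_alg free_scaleAr.

Lemma free_oneE : (1 : free_alg) = (1 : M).
Proof. by rewrite [LHS]/GRing.one /= /free_one -lock. Qed.
Lemma free_addE x y : x + y = (x : M) + y.
Proof. by rewrite [LHS]/GRing.add /= /free_add -lock. Qed.
Lemma free_oppE x : - x = - (x : M).
Proof. by rewrite [LHS]/GRing.opp /= /free_opp -lock. Qed.
Lemma free_mulE x y : x * y = (x : M) * y.
Proof. by rewrite [LHS]/GRing.mul /= /free_mul -lock. Qed.
Lemma free_scaleE c x : c *: x = c *: (x : M).
Proof. by rewrite [LHS]/GRing.scale /= /free_scale -lock. Qed.
Lemma free_genE s : free_gen s = mkmalgU (fmu s) (1 : K).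
Proof. by rewrite /free_gen -lock. Qed.

Section Eval.
Variables (B : algType K) (f : G -> B).

Definition word_eval (m : {fmonom G}) : B := \prod_(s <- (m : seq G)) f s.

Lemma word_eval_morph : mmorphism word_eval.
Proof.
split=> [x y|]; first by rewrite /word_eval fmM big_cat.
by rewrite /word_eval fm1 big_nil.
Qed.

HB.instance Definition _ := isMultiplicative.Build _ _ word_eval word_eval_morph.

Definition free_eval : free_alg -> B := locked (mmap (GRing.in_alg B) word_eval).

Lemma free_eval_zmod : zmod_morphism free_eval.
Proof.
move=> x y; rewrite free_addE free_oppE /free_eval -lock.
exact: mmap_is_additive.
Qed.

HB.instance Definition _ := GRing.isZmodMorphism.Build _ _ free_eval free_eval_zmod.

Lemma free_eval_monoid : monoid_morphism free_eval.
Proof.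
have H : multiplicative (mmap (GRing.in_alg B) word_eval).
  apply: commr_mmap_is_multiplicative => x m m'; rewrite /GRing.comm /=.
  by rewrite mulr_algl mulr_algr.
split=> [|x y].
  by rewrite free_oneE /free_eval -lock H.2.
by rewrite free_mulE /free_eval -lock H.1.
Qed.

HB.instance Definition _ := GRing.isMonoidMorphism.Build _ _ free_eval free_eval_monoid.

Lemma free_eval_scalable : scalable free_eval.
Proof.
move=> c x; rewrite free_scaleE /free_eval -lock.
by rewrite mmapZ /= mulr_algl.
Qed.

HB.instance Definition _ := GRing.isScalable.Build _ _ _ _ free_eval free_eval_scalable.

Lemma free_eval_gen s : free_eval (free_gen s) = f s.
Proof.
rewrite free_genE /free_eval -lock mmapU /= scale1r mul1r.
by rewrite /word_eval fmU big_seq1.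
Qed.

End Eval.
End FreeAlgebra.

Section AlgQuotient.
Variables (K : fieldType) (A : algType K).

Inductive ideal_of (S : set A) : set A :=
| ideal_gen x : S x -> ideal_of S x
| ideal_0 : ideal_of S 0
| ideal_add x y : ideal_of S x -> ideal_of S y -> ideal_of S (x + y)
| ideal_mull a x : ideal_of S x -> ideal_of S (a * x)
| ideal_mulr a x : ideal_of S x -> ideal_of S (x * a).

Lemma ideal_of_ker (B : pzRingType) (f : {rmorphism A -> B}) (S : set A) :
  (forall x, S x -> f x = 0) -> forall x, ideal_of S x -> f x = 0.
Proof.
move=> fS x; elim=> [y /fS //||y z _ + _|a y _ +|a y _ +].
- exact: rmorph0.
- by rewrite rmorphD => -> ->; rewrite addr0.
- by rewrite rmorphM => ->; rewrite mulr0.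
- by rewrite rmorphM => ->; rewrite mul0r.
Qed.

(* MathComp algebras are nonzero rings, whence the second field. *)
Record relators := Relators {
  relator :> set A;
  relators_proper : ~ ideal_of relator 1 }.

Lemma relators_properP (B : nzRingType) (f : {rmorphism A -> B}) (S : set A) :
  (forall x, S x -> f x = 0) -> ~ ideal_of S 1.
Proof.
move=> fS /(ideal_of_ker fS); rewrite rmorph1 => /eqP.
by rewrite oner_eq0.
Qed.

Variable S : relators.

Lemma ideal_opp x : ideal_of S x -> ideal_of S (- x).
Proof. by move=> Sx; rewrite -mulN1r; apply: ideal_mull. Qed.

Definition mod_ideal (x y : A) := `[< ideal_of S (x - y) >].

Lemma mod_ideal_refl : reflexive mod_ideal.
Proof. by move=> x; apply/asboolP; rewrite subrr; apply: ideal_0. Qed.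

Lemma mod_ideal_sym : symmetric mod_ideal.
Proof.
by move=> x y; apply/asboolP/asboolP => /ideal_opp; rewrite opprB.
Qed.

Lemma mod_ideal_trans : transitive mod_ideal.
Proof.
move=> y x z /asboolP xy /asboolP yz; apply/asboolP.
by rewrite -(subrKA y); apply: ideal_add.
Qed.

Canonical mod_ideal_equiv :=
  EquivRel mod_ideal mod_ideal_refl mod_ideal_sym mod_ideal_trans.

Definition quot_alg := {eq_quot mod_ideal}.

HB.instance Definition _ := Choice.on quot_alg.
HB.instance Definition _ := EqQuotient.on quot_alg.

Lemma quotP (x y : A) : \pi_quot_alg x = \pi y <-> ideal_of S (x - y).
Proof.
split; first by move=> /eqmodP /asboolP.
by move=> xy; apply/eqmodP/asboolP.
Qed.

Definition quot_zero : quot_alg := lift_cst quot_alg 0.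
Definition quot_opp := lift_op1 quot_alg -%R.
Definition quot_add := lift_op2 quot_alg +%R.
Definition quot_one : quot_alg := lift_cst quot_alg 1.
Definition quot_mul := lift_op2 quot_alg *%R.
Definition quot_scale (c : K) := lift_op1 quot_alg ( *:%R c).

Canonical pi_quot_zero := PiConst quot_zero.
Canonical pi_quot_one := PiConst quot_one.

Lemma pi_opp : {morph \pi : x / - x >-> quot_opp x}.
Proof.
move=> x; unlock quot_opp; apply/quotP.
by rewrite -opprD; apply: ideal_opp; apply/quotP; rewrite reprK.
Qed.
Canonical pi_quot_opp := PiMorph1 pi_opp.

Lemma pi_add : {morph \pi : x y / x + y >-> quot_add x y}.
Proof.
move=> x y; unlock quot_add; apply/quotP.
rewrite opprD addrACA; apply: ideal_add; apply/quotP; by rewrite reprK.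
Qed.
Canonical pi_quot_add := PiMorph2 pi_add.

Lemma pi_mul : {morph \pi : x y / x * y >-> quot_mul x y}.
Proof.
move=> x y; unlock quot_mul; apply/quotP.
set x' := repr _; set y' := repr _.
have -> : x * y - x' * y' = x * (y - y') + (x - x') * y'.
  by rewrite mulrBr mulrBl addrA subrK.
apply: ideal_add; [apply: ideal_mull | apply: ideal_mulr];
  by apply/quotP; rewrite reprK.
Qed.
Canonical pi_quot_mul := PiMorph2 pi_mul.

Lemma pi_scale c : {morph \pi : x / c *: x >-> quot_scale c x}.
Proof.
move=> x; unlock quot_scale; apply/quotP.
rewrite -scalerBr -mulr_algl; apply: ideal_mull.
by apply/quotP; rewrite reprK.
Qed.
Canonical pi_quot_scale c := PiMorph1 (pi_scale c).

Lemma quot_addA : associative quot_add.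
Proof. by elim/quotW=> x; elim/quotW=> y; elim/quotW=> z; rewrite !piE addrA. Qed.
Lemma quot_addC : commutative quot_add.
Proof. by elim/quotW=> x; elim/quotW=> y; rewrite !piE addrC. Qed.
Lemma quot_add0 : left_id quot_zero quot_add.
Proof. by elim/quotW=> x; rewrite !piE add0r. Qed.
Lemma quot_addN : left_inverse quot_zero quot_opp quot_add.
Proof. by elim/quotW=> x; rewrite !piE addNr. Qed.

HB.instance Definition _ :=
  GRing.isZmodule.Build quot_alg quot_addA quot_addC quot_add0 quot_addN.

Lemma quot_mulA : associative quot_mul.
Proof. by elim/quotW=> x; elim/quotW=> y; elim/quotW=> z; rewrite !piE mulrA. Qed.
Lemma quot_mul1l : left_id quot_one quot_mul.
Proof. by elim/quotW=> x; rewrite !piE mul1r. Qed.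
Lemma quot_mul1r : right_id quot_one quot_mul.
Proof. by elim/quotW=> x; rewrite !piE mulr1. Qed.
Lemma quot_mulDl : left_distributive quot_mul quot_add.
Proof. by elim/quotW=> x; elim/quotW=> y; elim/quotW=> z; rewrite !piE mulrDl. Qed.
Lemma quot_mulDr : right_distributive quot_mul quot_add.
Proof. by elim/quotW=> x; elim/quotW=> y; elim/quotW=> z; rewrite !piE mulrDr. Qed.
Lemma quot_1neq0 : quot_one != quot_zero.
Proof.
apply/eqP; rewrite !piE => /quotP; rewrite subr0.
exact: relators_proper.
Qed.

HB.instance Definition _ := GRing.Zmodule_isNzRing.Build quot_alg
  quot_mulA quot_mul1l quot_mul1r quot_mulDl quot_mulDr quot_1neq0.

Lemma quot_scaleA a b (v : quot_alg) :
  quot_scale a (quot_scale b v) = quot_scale (a * b) v.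
Proof. by elim/quotW: v => x; rewrite !piE scalerA. Qed.
Lemma quot_scale1 : left_id 1 quot_scale.
Proof. by elim/quotW=> x; rewrite !piE scale1r. Qed.
Lemma quot_scaleDr : right_distributive quot_scale +%R.
Proof.
move=> a; elim/quotW=> x; elim/quotW=> y.
by rewrite /GRing.add /= !piE scalerDr.
Qed.
Lemma quot_scaleDl (v : quot_alg) :
  {morph quot_scale^~ v : a b / a + b >-> a + b}.
Proof.
move=> a b; elim/quotW: v => x.
by rewrite [in RHS]/GRing.add /= !piE scalerDl.
Qed.

HB.instance Definition _ := GRing.Zmodule_isLmodule.Build K quot_alg
  quot_scaleA quot_scale1 quot_scaleDr quot_scaleDl.

Lemma quot_scalerAl a (u v : quot_alg) : a *: (u * v) = (a *: u) * v.
Proof.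
elim/quotW: u => x; elim/quotW: v => y.
by rewrite /GRing.mul /GRing.scale /= !piE scalerAl.
Qed.
HB.instance Definition _ := GRing.Lmodule_isLalgebra.Build K quot_alg quot_scalerAl.

Lemma quot_scalerAr a (u v : quot_alg) : a *: (u * v) = u * (a *: v).
Proof.
elim/quotW: u => x; elim/quotW: v => y.
by rewrite /GRing.mul /GRing.scale /= !piE scalerAr.
Qed.
HB.instance Definition _ := GRing.Lalgebra_isAlgebra.Build K quot_alg quot_scalerAr.

Definition quot_pi : A -> quot_alg := \pi.

Lemma quot_pi_zmod : zmod_morphism quot_pi.
Proof. by move=> x y; rewrite /quot_pi /GRing.add /GRing.opp /= !piE. Qed.
HB.instance Definition _ := GRing.isZmodMorphism.Build _ _ quot_pi quot_pi_zmod.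
Lemma quot_pi_monoid : monoid_morphism quot_pi.
Proof.
by split=> [|x y]; rewrite /quot_pi /GRing.one /GRing.mul /= !piE.
Qed.
HB.instance Definition _ := GRing.isMonoidMorphism.Build _ _ quot_pi quot_pi_monoid.
Lemma quot_pi_scalable : scalable quot_pi.
Proof. by move=> c x; rewrite /quot_pi /GRing.scale /= !piE. Qed.
HB.instance Definition _ := GRing.isScalable.Build _ _ _ _ quot_pi quot_pi_scalable.

Lemma quot_pi0 x : ideal_of S x -> quot_pi x = 0.
Proof. by move=> Sx; rewrite -(rmorph0 quot_pi); apply/quotP; rewrite subr0. Qed.

Lemma quot_pi_eq x y : relator S (x - y) -> quot_pi x = quot_pi y.
Proof. by move=> Sxy; apply/quotP/ideal_gen. Qed.

Section Lift.
Variables (B : algType K) (f : {lrmorphism A -> B}).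
Hypothesis fS : forall x, relator S x -> f x = 0.

Definition quot_lift of (forall x, relator S x -> f x = 0) :=
  fun u : quot_alg => f (repr u).
Local Notation fbar := (quot_lift fS).

Lemma quot_liftE x : fbar (quot_pi x) = f x.
Proof.
apply/eqP; rewrite -subr_eq0 -rmorphB; apply/eqP.
apply: (ideal_of_ker fS); apply/quotP; by rewrite reprK.
Qed.

Lemma quot_surj (u : quot_alg) : exists x, u = quot_pi x.
Proof. by exists (repr u); rewrite /quot_pi reprK. Qed.

Lemma quot_lift_zmod : zmod_morphism fbar.
Proof.
move=> u v; have [x ->] := quot_surj u; have [y ->] := quot_surj v.
by rewrite -rmorphB !quot_liftE rmorphB.
Qed.
HB.instance Definition _ := GRing.isZmodMorphism.Build _ _ fbar quot_lift_zmod.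
Lemma quot_lift_monoid : monoid_morphism fbar.
Proof.
split=> [|u v]; first by rewrite -(rmorph1 quot_pi) quot_liftE rmorph1.
have [x ->] := quot_surj u; have [y ->] := quot_surj v.
by rewrite -rmorphM !quot_liftE rmorphM.
Qed.
HB.instance Definition _ := GRing.isMonoidMorphism.Build _ _ fbar quot_lift_monoid.
Lemma quot_lift_scalable : scalable fbar.
Proof.
move=> c u; have [x ->] := quot_surj u.
by rewrite -linearZ !quot_liftE linearZ.
Qed.
HB.instance Definition _ := GRing.isScalable.Build _ _ _ _ fbar quot_lift_scalable.
End Lift.
End AlgQuotient.

Section TensorProduct.
Variables (K : fieldType) (A B : algType K).

Definition tens_gens : choiceType := (A + B)%type.

Local Notation free := (free_alg K tens_gens).
Local Notation l a := (free_gen K (inl a : tens_gens)).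
Local Notation r b := (free_gen K (inr b : tens_gens)).

(* A (x) B, as the universal algebra receiving A and B with commuting images *)
Inductive tens_rel : set free :=
| tens_l1 : tens_rel (l 1 - 1)
| tens_lD a a' : tens_rel (l (a + a') - (l a + l a'))
| tens_lZ c a : tens_rel (l (c *: a) - c *: l a)
| tens_lM a a' : tens_rel (l (a * a') - l a * l a')
| tens_r1 : tens_rel (r 1 - 1)
| tens_rD b b' : tens_rel (r (b + b') - (r b + r b'))
| tens_rZ c b : tens_rel (r (c *: b) - c *: r b)
| tens_rM b b' : tens_rel (r (b * b') - r b * r b')
| tens_lr a b : tens_rel (l a * r b - r b * l a).

Section Eval.
Variables (C : algType K) (f : {lrmorphism A -> C}) (g : {lrmorphism B -> C}).
Hypothesis fgC : forall a b, f a * g b = g b * f a.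

Definition tens_eval : free -> C :=
  free_eval (fun s : tens_gens => match s with inl a => f a | inr b => g b end).
HB.instance Definition _ := GRing.LRMorphism.on tens_eval.

Lemma tens_eval_rel x : tens_rel x -> tens_eval x = 0.
Proof.
pose e : {lrmorphism free -> C} := tens_eval.
have el a : e (l a) = f a by exact: free_eval_gen.
have er b : e (r b) = g b by exact: free_eval_gen.
suff : tens_rel x -> e x = 0 by [].
move: e el er => e el er.
case=> [|a a'|c a|a a'||b b'|c b|b b'|a b]; rewrite (raddfB e) /=.
- by rewrite el !rmorph1 subrr.
- by rewrite (raddfD e) /= !el raddfD subrr.
- by rewrite (linearZZ e) /= !el linearZZ subrr.
- by rewrite (rmorphM e) /= !el rmorphM subrr.
- by rewrite er !rmorph1 subrr.
- by rewrite (raddfD e) /= !er raddfD subrr.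
- by rewrite (linearZZ e) /= !er linearZZ subrr.
- by rewrite (rmorphM e) /= !er rmorphM subrr.
- rewrite (rmorphM e (l a) (r b)) (rmorphM e (r b) (l a)) /=.
  by rewrite (el a) (er b) (fgC a b) (subrr (g b * f a)).
Qed.
End Eval.

Hypothesis proper : ~ ideal_of tens_rel 1.

Definition tens_alg := quot_alg (Relators proper).
HB.instance Definition _ := GRing.Algebra.on tens_alg.

Definition tens_inl (a : A) : tens_alg := quot_pi (Relators proper) (l a).
Definition tens_inr (b : B) : tens_alg := quot_pi (Relators proper) (r b).

Lemma tens_inl_zmod : zmod_morphism tens_inl.
Proof.
suff D a a' : tens_inl (a + a') = tens_inl a + tens_inl a'.
  by move=> a a'; apply: (addIr (tens_inl a')); rewrite -D !subrK.
exact: etrans (@quot_pi_eq _ _ (Relators proper) _ _ (tens_lD a a')) (raddfD _ _ _).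
Qed.
HB.instance Definition _ := GRing.isZmodMorphism.Build _ _ tens_inl tens_inl_zmod.

Lemma tens_inl_monoid : monoid_morphism tens_inl.
Proof.
split=> [|a a']; first exact: etrans (@quot_pi_eq _ _ (Relators proper) _ _ tens_l1) (rmorph1 _).
exact: etrans (@quot_pi_eq _ _ (Relators proper) _ _ (tens_lM a a')) (rmorphM _ _ _).
Qed.
HB.instance Definition _ := GRing.isMonoidMorphism.Build _ _ tens_inl tens_inl_monoid.

Lemma tens_inl_scalable : scalable tens_inl.
Proof.
by move=> c a; exact: etrans (@quot_pi_eq _ _ (Relators proper) _ _ (tens_lZ c a)) (linearZZ _ _ _).
Qed.
HB.instance Definition _ := GRing.isScalable.Build _ _ _ _ tens_inl tens_inl_scalable.

Lemma tens_inr_zmod : zmod_morphism tens_inr.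
Proof.
suff D a a' : tens_inr (a + a') = tens_inr a + tens_inr a'.
  by move=> a a'; apply: (addIr (tens_inr a')); rewrite -D !subrK.
exact: etrans (@quot_pi_eq _ _ (Relators proper) _ _ (tens_rD a a')) (raddfD _ _ _).
Qed.
HB.instance Definition _ := GRing.isZmodMorphism.Build _ _ tens_inr tens_inr_zmod.

Lemma tens_inr_monoid : monoid_morphism tens_inr.
Proof.
split=> [|a a']; first exact: etrans (@quot_pi_eq _ _ (Relators proper) _ _ tens_r1) (rmorph1 _).
exact: etrans (@quot_pi_eq _ _ (Relators proper) _ _ (tens_rM a a')) (rmorphM _ _ _).
Qed.
HB.instance Definition _ := GRing.isMonoidMorphism.Build _ _ tens_inr tens_inr_monoid.

Lemma tens_inr_scalable : scalable tens_inr.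
Proof.
by move=> c a; exact: etrans (@quot_pi_eq _ _ (Relators proper) _ _ (tens_rZ c a)) (linearZZ _ _ _).
Qed.
HB.instance Definition _ := GRing.isScalable.Build _ _ _ _ tens_inr tens_inr_scalable.

Lemma tens_inC a b : tens_inl a * tens_inr b = tens_inr b * tens_inl a.
Proof.
rewrite /tens_inl /tens_inr -!(rmorphM (quot_pi (Relators proper))).
exact: (@quot_pi_eq _ _ (Relators proper) _ _ (tens_lr a b)).
Qed.

Definition tensor (a : A) (b : B) : tens_alg := tens_inl a * tens_inr b.

(* P (x) Q, for P and Q subspaces of A and B *)
Definition in_tensor (P : set A) (Q : set B) (u : tens_alg) : Prop :=
  exists s : seq (A * B), (forall ab, ab \in s -> P ab.1 /\ Q ab.2) /\
    u = \sum_(ab <- s) tensor ab.1 ab.2.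

Section Lift.
Variables (C : algType K) (f : {lrmorphism A -> C}) (g : {lrmorphism B -> C}).
Hypothesis fgC : forall a b, f a * g b = g b * f a.

Definition tens_lift : tens_alg -> C :=
  @quot_lift _ _ (Relators proper) _ (tens_eval f g) (tens_eval_rel fgC).
HB.instance Definition _ := GRing.LRMorphism.on tens_lift.

Lemma tens_lift_inl a : tens_lift (tens_inl a) = f a.
Proof. exact: etrans (quot_liftE _ _) (free_eval_gen _ _). Qed.

Lemma tens_lift_inr b : tens_lift (tens_inr b) = g b.
Proof. exact: etrans (quot_liftE _ _) (free_eval_gen _ _). Qed.

Lemma tens_liftE a b : tens_lift (tensor a b) = f a * g b.
Proof. by rewrite /tensor rmorphM /= tens_lift_inl tens_lift_inr. Qed.
End Lift.
End TensorProduct.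

(* ------------------------------------------------------------------------ *)
(* Lie data.                                                                *)

(* A complex simple Lie algebra of rank n, through its Cartan matrix (a_ij)
   and the half square lengths d_i of its simple roots, the index set I being
   'I_n. Short simple roots have square length 2 by cartan_short. *)
Record simple_datum (n : nat) := SimpleDatum {
  cartan : 'M[int]_n;
  dlen : 'I_n -> nat;
  dlen_gt0 : forall i, (0 < dlen i)%N;
  dlen_short : exists i, dlen i = 1%N;
  cartan_diag : forall i, cartan i i = 2;
  cartan_le0 : forall i j, i != j -> cartan i j <= 0;
  cartan_sym : forall i j,
    (dlen i)%:Z * cartan i j = (dlen j)%:Z * cartan j i;
  cartan_posdef : forall b : 'rV[int]_n, b != 0 ->
    0 < \sum_i \sum_j b 0 i * ((dlen i)%:Z * cartan i j) * b 0 j;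
  cartan_irr : forall J : {set 'I_n}, J != finset.set0 -> J != finset.setT ->
    exists i j, [/\ i \in J, j \notin J & cartan i j != 0] }.

Section LieData.
Variables (n : nat) (g : simple_datum n).

(* The root lattice Q, in the basis of simple roots; the weight lattice is
   'rV[int]_n as well, but in the basis of fundamental weights. *)
Local Notation Q := 'rV[int]_n.
Local Notation P := 'rV[int]_n.

Definition sroot (i : 'I_n) : Q := delta_mx 0 i.

Definition Qplus : set Q := [set b | forall i, 0 <= b 0 i].

Definition Qplus_below (b : Q) : set Q := [set nu | Qplus nu /\ Qplus (b - nu)].

Definition root_form (b c : Q) : int :=
  \sum_i \sum_j b 0 i * ((dlen g i)%:Z * cartan g i j) * c 0 j.

(* (mu, b) for mu in P and b in Q, as (omega_i, alpha_j) = d_i delta_ij *)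
Definition weight_root_form (mu : P) (b : Q) : int :=
  \sum_i mu 0 i * (dlen g i)%:Z * b 0 i.

(* The inclusion of Q in P: alpha_j = \sum_i a_ij omega_i. *)
Definition root_weight (b : Q) : P := \row_i \sum_j cartan g i j * b 0 j.

(* The form on P takes rational values: its Gram matrix on fundamental weights
   is D C^-1 D for D = diag(d_i) and C the Gram matrix (alpha_i, alpha_j). *)
Definition sroot_gram : 'M[rat]_n :=
  \matrix_(i, j) ((dlen g i)%:R * (cartan g i j)%:~R).

Definition dlen_mx : 'M[rat]_n := diag_mx (\row_i (dlen g i)%:R).

Definition weight_form (mu nu : P) : rat :=
  (map_mx intr mu *m (dlen_mx *m invmx sroot_gram *m dlen_mx)
     *m (map_mx intr nu)^T) 0 0.

Definition dominant (lam : P) : Prop := forall i, 0 <= lam 0 i.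

End LieData.

(* ------------------------------------------------------------------------ *)
(* q-numbers.                                                               *)

Notation Qq := {fraction {poly rat}}.

Definition qv : Qq := tofrac 'X.

Definition qint (v : Qq) (m : nat) : Qq := (v ^+ m - v ^- m) / (v - v^-1).
Definition qfact (v : Qq) (m : nat) : Qq := \prod_(1 <= k < m.+1) qint v k.
Definition qbin (v : Qq) (m r : nat) : Qq :=
  qfact v m / (qfact v r * qfact v (m - r)).

Definition qserre (A : algType Qq) (v : Qq) (m : nat) (x y : A) : A :=
  \sum_(r < m.+1) ((-1) ^+ r * qbin v m r) *: (x ^+ r * y * x ^+ (m - r)).

(* ------------------------------------------------------------------------ *)
(* The quantum group.                                                       *)

Section QuantumGroup.
Variables (n : nat) (g : simple_datum n).
Local Notation Q := 'rV[int]_n.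

Definition qi (i : 'I_n) : Qq := qv ^+ dlen g i.

(* 1 - a_ij, a natural number for i != j *)
Definition serre_deg (i j : 'I_n) : nat := `|1 - cartan g i j|%N.

Definition Uq_gens : choiceType := ('I_n + 'I_n + Q)%type.

Local Notation free := (free_alg Qq Uq_gens).
Local Notation fE i := (free_gen Qq (inl (inl i) : Uq_gens)).
Local Notation fF i := (free_gen Qq (inl (inr i) : Uq_gens)).
Local Notation fK mu := (free_gen Qq (inr mu : Uq_gens)).

Inductive Uq_rel : set free :=
| Uq_K0 : Uq_rel (fK 0 - 1)
| Uq_KK mu nu : Uq_rel (fK mu * fK nu - fK (mu + nu))
| Uq_KE mu j : Uq_rel
    (fK mu * fE j * fK (- mu) - qv ^ root_form g mu (sroot j) *: fE j)
| Uq_KF mu j : Uq_rel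
    (fK mu * fF j * fK (- mu) - qv ^ (- root_form g mu (sroot j)) *: fF j)
| Uq_EF i j : Uq_rel
    (fE i * fF j - fF j * fE i -
     ((i == j)%:R / (qi i - (qi i)^-1)) *: (fK (sroot i) - fK (- sroot i)))
| Uq_serreE i j of i != j : Uq_rel (qserre (qi i) (serre_deg i j) (fE i) (fE j))
| Uq_serreF i j of i != j : Uq_rel (qserre (qi i) (serre_deg i j) (fF i) (fF j)).

Lemma qserre0 (A : algType Qq) v m (x : A) : qserre v m x 0 = 0.
Proof. by rewrite /qserre big1 // => r _; rewrite mulr0 mul0r scaler0. Qed.

Lemma rmorph_qserre (A B : algType Qq) (f : {lrmorphism A -> B}) v m x y :
  f (qserre v m x y) = qserre v m (f x) (f y).
Proof.
rewrite /qserre raddf_sum; apply: eq_bigr => r _ /=.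
by rewrite linearZZ !rmorphM !rmorphXn.
Qed.

Definition Uq_counit0 : free -> Qq^o :=
  free_eval (fun s : Uq_gens => match s with inl _ => 0 | inr _ => 1 end).
HB.instance Definition _ := GRing.LRMorphism.on Uq_counit0.

Lemma Uq_counit0_rel x : Uq_rel x -> Uq_counit0 x = 0.
Proof.
pose e : {lrmorphism free -> Qq^o} := Uq_counit0.
have eE i : e (fE i) = 0 by exact: free_eval_gen.
have eF i : e (fF i) = 0 by exact: free_eval_gen.
have eK mu : e (fK mu) = 1 by exact: free_eval_gen.
suff : Uq_rel x -> e x = 0 by [].
move: e eE eF eK => e eE eF eK.
case=> [|mu nu|mu j|mu j|i j|i j _|i j _].
- by rewrite (raddfB e) /= eK rmorph1 subrr.
- by rewrite (raddfB e) /= (rmorphM e) /= !eK mulr1 subrr.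
- rewrite (raddfB e) /= (linearZZ e) /= (rmorphM e (fK mu * fE j)) /=.
  by rewrite (rmorphM e (fK mu)) /= eE mulr0 mul0r scaler0 subrr.
- rewrite (raddfB e) /= (linearZZ e) /= (rmorphM e (fK mu * fF j)) /=.
  by rewrite (rmorphM e (fK mu)) /= eF mulr0 mul0r scaler0 subrr.
- rewrite (raddfB e) /= (linearZZ e) /= (raddfB e) /= (raddfB e (fK _)) /=.
  rewrite (rmorphM e (fE i)) (rmorphM e (fF j)) /= eE eF !eK.
  by rewrite !mul0r !subrr scaler0 subrr.
- by rewrite rmorph_qserre !eE qserre0.
- by rewrite rmorph_qserre !eF qserre0.
Qed.

Lemma Uq_proper : ~ ideal_of Uq_rel 1.
Proof. exact: (relators_properP (f := Uq_counit0)) Uq_counit0_rel. Qed.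

Definition Uq := quot_alg (Relators Uq_proper).
HB.instance Definition _ := GRing.Algebra.on Uq.

Definition Eg (i : 'I_n) : Uq := quot_pi (Relators Uq_proper) (fE i).
Definition Fg (i : 'I_n) : Uq := quot_pi (Relators Uq_proper) (fF i).
Definition Kg (mu : Q) : Uq := quot_pi (Relators Uq_proper) (fK mu).

Definition Uq_counit : Uq -> Qq^o :=
  @quot_lift _ _ (Relators Uq_proper) _ Uq_counit0 Uq_counit0_rel.
HB.instance Definition _ := GRing.LRMorphism.on Uq_counit.

Lemma UqUq_proper : ~ ideal_of (@tens_rel Qq Uq Uq) 1.
Proof.
apply: (relators_properP (f := tens_eval Uq_counit Uq_counit)).
by apply: tens_eval_rel => a b; rewrite [RHS]mulrC.
Qed.

Definition UqUq := tens_alg UqUq_proper.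
HB.instance Definition _ := GRing.Algebra.on UqUq.

Definition tensU (a b : Uq) : UqUq := tensor UqUq_proper a b.

Definition Uq_deg (b : Q) : set Uq :=
  [set x | forall mu, Kg mu * x * Kg (- mu) = qv ^ root_form g b mu *: x].

Inductive gen_subalg (A : algType Qq) (S : set A) : set A :=
| gen_subalg_in x : S x -> gen_subalg S x
| gen_subalg_1 : gen_subalg S 1
| gen_subalg_D x y : gen_subalg S x -> gen_subalg S y -> gen_subalg S (x + y)
| gen_subalg_Z c x : gen_subalg S x -> gen_subalg S (c *: x)
| gen_subalg_M x y : gen_subalg S x -> gen_subalg S y -> gen_subalg S (x * y).

Definition Uq_npos : set Uq := gen_subalg (range Eg).
Definition Uq_nneg : set Uq := gen_subalg (range Fg).
Definition Uq_bpos : set Uq := gen_subalg (range Eg `|` range Kg).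
Definition Uq_bneg : set Uq := gen_subalg (range Fg `|` range Kg).

Definition is_coproduct (Delta : {lrmorphism Uq -> UqUq}) : Prop :=
  [/\ forall mu, Delta (Kg mu) = tensU (Kg mu) (Kg mu),
      forall i, Delta (Eg i) = tensU (Eg i) (Kg (sroot i)) + tensU 1 (Eg i)
    & forall i, Delta (Fg i) = tensU (Fg i) 1 + tensU (Kg (- sroot i)) (Fg i)].

Definition is_Psi (Psi : {lrmorphism UqUq -> UqUq}) : Prop :=
  bijective Psi /\ forall i,
  [/\ Psi (tensU (Kg (sroot i)) 1) = tensU (Kg (sroot i)) 1,
      Psi (tensU 1 (Kg (sroot i))) = tensU 1 (Kg (sroot i)),
      Psi (tensU (Eg i) 1) = tensU (Eg i) (Kg (- sroot i))
        /\ Psi (tensU (Fg i) 1) = tensU (Fg i) (Kg (sroot i))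
    & Psi (tensU 1 (Eg i)) = tensU (Kg (- sroot i)) (Eg i)
        /\ Psi (tensU 1 (Fg i)) = tensU (Kg (sroot i)) (Fg i)].

Lemma tens_flipC (a b : Uq) :
  tens_inr UqUq_proper a * tens_inl UqUq_proper b =
  tens_inl UqUq_proper b * tens_inr UqUq_proper a.
Proof. by rewrite tens_inC. Qed.

Definition flipU : UqUq -> UqUq :=
  tens_lift (f := tens_inr UqUq_proper) (g := tens_inl UqUq_proper)
    tens_flipC.

(* The components c b of u in Uq_b (x) Uq, resp. in Uq (x) Uq_b. *)
Definition leg1_components (u : UqUq) (c : Q -> UqUq) : Prop :=
  [/\ finite_set [set b | c b != 0],
      forall b, in_tensor (Uq_deg b) [set: Uq] (c b)
    & u = \sum_(b \in [set: Q]) c b].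

Definition leg2_components (u : UqUq) (c : Q -> UqUq) : Prop :=
  [/\ finite_set [set b | c b != 0],
      forall b, in_tensor [set: Uq] (Uq_deg b) (c b)
    & u = \sum_(b \in [set: Q]) c b].

(* Only the values of R at Qplus are relevant. *)
Record is_Rplus (Delta : {lrmorphism Uq -> UqUq})
    (Psi : {lrmorphism UqUq -> UqUq}) (R : Q -> UqUq) : Prop := {
  Rplus_deg : forall nu, Qplus nu ->
    in_tensor (Uq_npos `&` Uq_deg nu) (Uq_nneg `&` Uq_deg (- nu)) (R nu);
  Rplus_0 : R 0 = 1;
  Rplus_bpos : forall b x c c', Qplus b -> Uq_bpos x ->
    leg1_components (Delta x) c ->
    leg1_components (flipU (Psi (Delta x))) c' ->
    \sum_(nu \in Qplus_below b) (R nu * c (b - nu) - c' (b - nu) * R nu) = 0;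
  Rplus_bneg : forall b y c c', Qplus b -> Uq_bneg y ->
    leg2_components (Delta y) c ->
    leg2_components (flipU (Psi (Delta y))) c' ->
    \sum_(nu \in Qplus_below b) (R nu * c (nu - b) - c' (nu - b) * R nu) = 0 }.

End QuantumGroup.

(* ------------------------------------------------------------------------ *)
(* The module V and the R-matrix.                                           *)

Lemma tens11 (A : pzRingType) (p q : nat) :
  (1%:M : 'M[A]_p) *t (1%:M : 'M[A]_q) = 1%:M.
Proof.
apply/matrixP=> i j; case: (mxtens_indexP i) => i0 i1.
case: (mxtens_indexP j) => j0 j1; rewrite tensmxE !mxE -natrM mulnb.
by rewrite (can_eq (@mxtens_indexK _ _)) xpair_eqE.
Qed.

Section Module.
Variables (n : nat) (g : simple_datum n) (N : nat).
Local Notation Q := 'rV[int]_n.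
Local Notation P := 'rV[int]_n.

(* V is a nonzero space of column vectors, on which matrices act on the left. *)
Local Notation V := 'cV[Qq]_N.+1.
Local Notation EndV := 'M[Qq]_N.+1.

Variables (pi : {lrmorphism Uq g -> EndV}) (wt : 'I_N.+1 -> P) (lam : P).

Definition weight_space (mu : P) : set V :=
  [set w | forall b, pi (Kg g b) *m w = qv ^ weight_root_form g mu b *: w].

Definition weights : set P :=
  [set mu | exists2 w, weight_space mu w & w != 0].

Definition submodule (W : set V) : Prop :=
  [/\ W 0, forall v w, W v -> W w -> W (v + w),
      forall c w, W w -> W (c *: w) & forall x w, W w -> W (pi x *m w)].

(* The standard basis consists of weight vectors, which makes V a type 1 module;
   conversely any such module has a basis of weight vectors. *)
Record is_irr_module : Prop := {
  irr_basis : forall k, weight_space (wt k) (delta_mx k 0);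
  irr_simple : forall W, submodule W -> W = [set 0] \/ W = [set: V];
  irr_highest : exists w, [/\ w != 0, weight_space lam w &
                           forall i, pi (Eg g i) *m w = 0] }.

(* The component of degree b of T in End(V) (x) A: the matrix unit at (k, l)
   maps the weight space of wt l to that of wt k. *)
Definition deg_comp (A : zmodType) (b : Q) (T : 'M[A]_N.+1) : 'M[A]_N.+1 :=
  \matrix_(k, l) (if wt k == wt l + root_weight g b then T k l else 0).

Definition weight_proj (mu : P) : EndV := diag_mx (\row_k (wt k == mu)%:R).

(* The exponents are integers, lam - mu and lam - nu being in Q. *)
Definition Dmx : 'M[Qq]_(N.+1 * N.+1) :=
  \sum_(mu \in weights) \sum_(nu \in weights)
    qv ^ Num.floor (weight_form g mu nu - weight_form g lam lam)
      *: (weight_proj mu *t weight_proj nu).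

Definition pi_leg1 (x : Uq g) : 'M[Qq]_(N.+1 * N.+1) := pi x *t (1%:M : EndV).
Definition pi_leg2 (x : Uq g) : 'M[Qq]_(N.+1 * N.+1) := (1%:M : EndV) *t pi x.

Lemma pi_leg1_zmod : zmod_morphism pi_leg1.
Proof. by move=> x y; apply/matrixP => i j; rewrite !mxE raddfB !mxE mulrBl. Qed.
HB.instance Definition _ := GRing.isZmodMorphism.Build _ _ pi_leg1 pi_leg1_zmod.

Lemma pi_leg1_monoid : monoid_morphism pi_leg1.
Proof.
split=> [|x y]; first by rewrite /pi_leg1 (rmorph1 pi); exact: tens11.
by rewrite /pi_leg1 (rmorphM pi) [RHS]tensmx_mul mulmx1.
Qed.
HB.instance Definition _ := GRing.isMonoidMorphism.Build _ _ pi_leg1 pi_leg1_monoid.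

Lemma pi_leg1_scalable : scalable pi_leg1.
Proof. by move=> c x; apply/matrixP => i j; rewrite !mxE linearZZ !mxE mulrA. Qed.
HB.instance Definition _ := GRing.isScalable.Build _ _ _ _ pi_leg1 pi_leg1_scalable.

Lemma pi_leg2_zmod : zmod_morphism pi_leg2.
Proof. by move=> x y; apply/matrixP => i j; rewrite !mxE raddfB !mxE mulrBr. Qed.
HB.instance Definition _ := GRing.isZmodMorphism.Build _ _ pi_leg2 pi_leg2_zmod.

Lemma pi_leg2_monoid : monoid_morphism pi_leg2.
Proof.
split=> [|x y]; first by rewrite /pi_leg2 (rmorph1 pi); exact: tens11.
by rewrite /pi_leg2 (rmorphM pi) [RHS]tensmx_mul mulmx1.
Qed.
HB.instance Definition _ := GRing.isMonoidMorphism.Build _ _ pi_leg2 pi_leg2_monoid.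

Lemma pi_leg2_scalable : scalable pi_leg2.
Proof. by move=> c x; apply/matrixP => i j; rewrite !mxE linearZZ !mxE mulrCA. Qed.
HB.instance Definition _ := GRing.isScalable.Build _ _ _ _ pi_leg2 pi_leg2_scalable.

Lemma pi_legC x y : pi_leg1 x * pi_leg2 y = pi_leg2 y * pi_leg1 x.
Proof.
by rewrite /pi_leg1 /pi_leg2 [LHS]tensmx_mul [RHS]tensmx_mul !mul1mx !mulmx1.
Qed.

Definition pi_pi : UqUq g -> 'M[Qq]_(N.+1 * N.+1) :=
  tens_lift (proper := @UqUq_proper n g) (f := pi_leg1) (g := pi_leg2) pi_legC.
HB.instance Definition _ := GRing.LRMorphism.on pi_pi.

Lemma pi_piE x y : pi_pi (tensU x y) = pi x *t pi y.
Proof.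
transitivity ((pi x *t (1%:M : EndV)) *m ((1%:M : EndV) *t pi y)).
  exact: (tens_liftE _ pi_legC x y).
by rewrite tensmx_mul mulmx1 mul1mx.
Qed.

(* The support of the sum is finite when Rp is as in is_Rplus. *)
Definition Rmx (Rp : Q -> UqUq g) : 'M[Qq]_(N.+1 * N.+1) :=
  Dmx *m \sum_(nu \in @Qplus n) pi_pi (Rp nu).

End Module.

(* ------------------------------------------------------------------------ *)
(* The algebra U_R^lambda(g).                                               *)

Section RMatrixAlgebra.
Variables (n : nat) (g : simple_datum n) (N : nat).
Variables (wt : 'I_N.+1 -> 'rV[int]_n) (R : 'M[Qq]_(N.+1 * N.+1)).

(* (s, k, l) stands for the (k, l) coefficient of L^+ if s, of L^- otherwise. *)
Definition UR_gens : choiceType := (bool * 'I_N.+1 * 'I_N.+1)%type.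

Local Notation free := (free_alg Qq UR_gens).

Definition in_cone (s : bool) (mu : 'rV[int]_n) : Prop :=
  exists2 b, Qplus b & mu = root_weight g (if s then b else - b).

Section Legs.
Variable A : pzRingType.
Definition leg1 (T : 'M[A]_N.+1) : 'M[A]_(N.+1 * N.+1) :=
  T *t (1%:M : 'M[A]_N.+1).
Definition leg2 (T : 'M[A]_N.+1) : 'M[A]_(N.+1 * N.+1) :=
  (1%:M : 'M[A]_N.+1) *t T.
End Legs.

Definition fL (s : bool) : 'M[free]_N.+1 :=
  \matrix_(k, l) free_gen Qq ((s, k, l) : UR_gens).

Local Notation fL0 s := (deg_comp g wt 0 (fL s)).
Local Notation fR := (map_mx (GRing.in_alg free) R).

Inductive UR_rel : set free :=
| UR_deg s k l of ~ in_cone s (wt k - wt l) : UR_rel (fL s k l)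
| UR_inv s k l : UR_rel ((fL0 s *m fL0 (~~ s) - 1%:M) k l)
| UR_RLL s k l : UR_rel
    ((fR *m leg1 (fL s) *m leg2 (fL s) - leg2 (fL s) *m leg1 (fL s) *m fR) k l)
| UR_RLLpm k l : UR_rel
    ((fR *m leg1 (fL true) *m leg2 (fL false) -
      leg2 (fL false) *m leg1 (fL true) *m fR) k l).

Definition UR_counit : free -> Qq^o :=
  free_eval (fun s : UR_gens => (s.1.2 == s.2)%:R : Qq^o).
HB.instance Definition _ := GRing.LRMorphism.on UR_counit.

Lemma UR_counit_rel x : UR_rel x -> UR_counit x = 0.
Proof.
pose e : {lrmorphism free -> Qq^o} := UR_counit.
suff : UR_rel x -> e x = 0 by [].
have eL s : map_mx e (fL s) = 1%:M.
  by apply/matrixP => k l; rewrite !mxE [LHS]free_eval_gen.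
move: e eL => e eL.
have eL1 s : map_mx e (leg1 (fL s)) = 1%:M.
  by rewrite /leg1 map_mxT eL map_mx1; exact: tens11.
have eL2 s : map_mx e (leg2 (fL s)) = 1%:M.
  by rewrite /leg2 map_mxT eL map_mx1; exact: tens11.
have eL0 s : map_mx e (fL0 s) = 1%:M.
  apply/matrixP => k l; rewrite 2!mxE; have /matrixP /(_ k l) := eL s.
  rewrite !mxE => el; case: eqP => [_|ne]; first exact: el.
  case: (k =P l) => [kl|_]; last by rewrite raddf0.
  case: ne; rewrite kl (_ : root_weight g 0 = 0) ?addr0 //.
  by apply/rowP => i; rewrite !mxE big1 // => j _; rewrite mxE mulr0.
have eM p (M M' : 'M[free]_p) k l :
    map_mx e M = map_mx e M' -> e ((M - M') k l) = 0.
  move=> /matrixP /(_ k l); rewrite !mxE => EM.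
  by rewrite raddfB /= EM subrr.
case=> [s k l kl|s k l|s k l|k l].
- have /matrixP /(_ k l) := eL s; rewrite [LHS]mxE => ->.
  rewrite mxE; case: eqP => // ekl; case: kl; exists 0 => [i|].
    by rewrite mxE.
  rewrite ekl subrr oppr0 if_same; apply/rowP => i.
  by rewrite !mxE big1 // => j _; rewrite mxE mulr0.
- by apply: eM; rewrite map_mxM !eL0 mulmx1 map_mx1.
- by apply: eM; rewrite !map_mxM eL1 eL2 !mulmx1 !mul1mx.
- by apply: eM; rewrite !map_mxM eL1 eL2 !mulmx1 !mul1mx.
Qed.

Lemma UR_proper : ~ ideal_of UR_rel 1.
Proof. exact: (relators_properP (f := UR_counit)) UR_counit_rel. Qed.

Definition UR := quot_alg (Relators UR_proper).
HB.instance Definition _ := GRing.Algebra.on UR.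

Definition Lmx (s : bool) : 'M[UR]_N.+1 :=
  map_mx (quot_pi (Relators UR_proper)) (fL s).

(* Characterizes X_i, the inverse of the degree 0 part of L^+ being that of L^-. *)
Definition is_X (pi : {lrmorphism Uq g -> 'M[Qq]_N.+1}) (i : 'I_n) (X : UR) : Prop :=
  deg_comp g wt (sroot i) (deg_comp g wt 0 (Lmx false) *m Lmx true) =
  \matrix_(k, l) (pi (Eg g i) k l *: X).

End RMatrixAlgebra.

(* Main.v *)
Require Import Defs.
From HB Require Import structures.
From mathcomp Require Import all_boot all_order all_algebra.
From mathcomp Require Import boolp classical_sets fsbigop.
From mathcomp Require Import fraction mxtens.
From mathcomp Require Import ring.

(* Write l for the degree 0 part of L^+, E_i, F_i, K_i for the images in End(V), and let
   c_i be the scalar for which the degree alpha_i part of R is D (c_i E_i (x) F_i). The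
   relation R L_1 L_2 = L_2 L_1 R for L = L^+ gives
   - in first-leg degree 0, that the entries of l commute and X_i l = K_i l X_i;
   - in first-leg degree alpha_i, a scalar k_i such that
       (X_i + c_i k_i F_i) L = L (X_i K_i^-1 + c_i F_i).
   Let S be the quantum Serre expression and theta = (1 - a_ij) alpha_i + alpha_j its
   weight. On both sides of the second relation the two summands q-commute in such a way
   that S is additive, and S(F_i, F_j) = 0, so S(X) L = L S(X) K_theta^-1 and therefore
   S(X) l = l S(X) K_theta^-1. But the first relation gives S(X) l = K_theta l S(X).
   Hence (K_theta - K_theta^-1) S(X) = 0, and S(X) = 0 because some weight of V is not
   orthogonal to theta. *)

Set Implicit Arguments.
Unset Strict Implicit.
Unset Printing Implicit Defensive.

Import Order.TTheory GRing.Theory Num.Theory.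
Local Open Scope ring_scope.

(** The Serre expression has degree theta, which is decomposable, so the theta component of the RLL
    relation would mix many components of R. The proof therefore stays in degrees 0 and alpha_i,
    where a product has at most two terms, and reaches theta multiplicatively: relations x_i L = L
    y_i pass to every noncommutative polynomial in the x_i. The obstacle is the cross terms of S on
    sums. X_j and F_i lie in different tensor factors and commute, so the q-commutation behind
    additivity must come from elsewhere. On the left it comes from k_i, which is not a number but a
    scalar matrix over the algebra, (l^-1 E_i l)_pq / (E_i)_pq for a fixed entry (p, q): X_j is
    twisted when it passes l^-1 E_i l. On the right it comes from K_i^-1, which q-commutes with F_j.
    The exponent 1 - a_ij is the one for which the cross terms cancel, because q^(alpha_i, alpha_j)
    q_i^(1 - a_ij) = q_i. *)

Lemma qv_neq0 : qv != 0.
Proof. by rewrite /qv tofrac_eq0 polyX_eq0. Qed.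

Lemma qv_expz_eq1 (z : int) : qv ^ z = 1 -> z = 0.
Proof.
suff H (m : nat) : qv ^+ m = 1 -> m = 0%N.
  case: z => [m|m]; first by move=> /H ->.
  by rewrite NegzE -exprnN => /eqP; rewrite invr_eq1 => /eqP /H.
rewrite /qv -tofracXn -tofrac1 => /eqP; rewrite tofrac_eq => /eqP.
move=> /(congr1 (fun p => size (p : {poly rat}))).
by rewrite size_polyXn size_poly1 => -[].
Qed.

Lemma qv_expz_inj (y z : int) : qv ^ y = qv ^ z -> y = z.
Proof.
move=> yz; apply/eqP; rewrite -subr_eq0; apply/eqP/qv_expz_eq1.
by rewrite expfzDr ?qv_neq0 // yz -expfzDr ?qv_neq0 // subrr.
Qed.

Lemma qv_expz_neq0 (z : int) : qv ^ z != 0.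
Proof. by rewrite expfz_neq0 // qv_neq0. Qed.

(** * Gaussian binomials and the quantum Serre expression *)

Section GaussianBinomial.
Variable F : fieldType.
Implicit Types v : F.

(* [qint], [qfact] and [qbin] over an abstract field, since unification tends to
   unfold the arithmetic of [Qq]. *)
Definition gint v m : F := (v ^+ m - v ^- m) / (v - v^-1).
Definition gfact v m : F := \prod_(1 <= k < m.+1) gint v k.
Definition gbin v m r : F := gfact v m / (gfact v r * gfact v (m - r)).

Lemma gintV v m : gint v^-1 m = gint v m.
Proof.
rewrite /gint invrK exprVn invrK -opprB -[v^-1 - v]opprB.
by rewrite invrN mulrNN.
Qed.

(** This symmetry lets [gserre_skew] treat its two summands alike: exchanging their roles inverts
    every commutation constant. *)
Lemma gbinV v m r : gbin v^-1 m r = gbin v m r.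
Proof.
have gfactV k : gfact v^-1 k = gfact v k by apply: eq_bigr => j _; exact: gintV.
by rewrite /gbin !gfactV.
Qed.

(* Agrees with [gbin] for [r <= m] only: [gbin v m r] is not 0 for [r > m]. *)
Fixpoint qpascal v (m r : nat) : F :=
  match m, r with
  | 0, 0 => 1
  | 0, _.+1 => 0
  | m'.+1, 0 => qpascal v m' 0
  | m'.+1, r'.+1 => v ^+ r * qpascal v m' r + v ^- (m' - r') * qpascal v m' r'
  end.

Lemma qpascal_small v m r : (m < r)%N -> qpascal v m r = 0.
Proof.
elim: m r => [|m IH] [|r] //= lt_mr.
by rewrite !IH ?mulr0 ?addr0 // ltnW.
Qed.

Lemma gbinE v m r : v != 0 -> (forall k : nat, v ^+ k = 1 -> k = 0%N) ->
  (r <= m)%N -> gbin v m r = qpascal v m r.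
Proof.
move=> v0 v_gen.
have w0 : v - v^-1 != 0.
  apply/eqP => /eqP; rewrite subr_eq0 => /eqP vV.
  by suff /v_gen : v ^+ 2 = 1 by []; rewrite expr2 {2}vV mulfV.
have q0 k : gint v k.+1 != 0.
  rewrite mulf_neq0 ?invr_eq0 //; apply/eqP => /eqP; rewrite subr_eq0 => /eqP vV.
  suff /v_gen : v ^+ (k.+1 + k.+1) = 1 by [].
  by rewrite exprD {2}vV mulfV // expf_neq0.
have gfactS k : gfact v k.+1 = gfact v k * gint v k.+1.
  by rewrite /gfact big_nat_recr.
have f0 k : gfact v k != 0.
  elim: k => [|k IH]; first by rewrite /gfact big_nil oner_neq0.
  by rewrite gfactS mulf_neq0.
have fact0 : gfact v 0 = 1 by rewrite /gfact big_nil.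
elim: m r => [|m IH] [|r] //=; rewrite ?ltnS => le_rm.
- by rewrite /gbin fact0 mulr1 divr1.
- by rewrite -IH // /gbin fact0 !mul1r !subn0 !mulfV ?f0.
(* For r = m the recursion calls [qpascal v m m.+1], outside the range where [gbin] and [qpascal]
   agree. *)
rewrite -(IH r) //; have [lt_rm|] := ltnP r m; last first.
  move=> le_mr; have {le_rm le_mr} -> : r = m by apply/eqP; rewrite eqn_leq le_rm.
  rewrite (@qpascal_small v m m.+1) // mulr0 add0r !subnn expr0 invr1 mul1r.
  by rewrite /gbin !subnn fact0 !mulr1 !mulfV.
rewrite -IH //; have [s ->] : exists s, m = (r + s).+1.
  by exists (m - r.+1)%N; rewrite -addSn subnKC.
have e1 : ((r + s).+2 - r.+1 = s.+1)%N by rewrite subSS -addnS addnC addnK.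
have e2 : ((r + s).+1 - r = s.+1)%N by rewrite -addnS addnC addnK.
have e3 : ((r + s).+1 - r.+1 = s)%N by rewrite subSS addnC addnK.
rewrite /gbin e1 e2 e3 !gfactS.
(* The q-Pascal rule on numerators: [a + b] = v^a [b] + v^-b [a] with a = r + 1 and b = s + 1. *)
have -> : gint v (r + s).+2 = v ^+ r.+1 * gint v s.+1 + v ^- s.+1 * gint v r.+1.
  rewrite /gint -addnS -addSn exprD.
  have := expf_neq0 r.+1 v0; have := expf_neq0 s.+1 v0.
  move: (v ^+ r.+1) (v ^+ s.+1) => a b b0 a0.
  rewrite !invfM !mulrA -mulrDl; congr (_ * _); field.
  by rewrite a0 b0.
have := f0 r; have := f0 s; have := q0 r; have := q0 s.
have := expf_neq0 s.+1 v0.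
move: (v ^+ r.+1) (v ^+ s.+1) (gfact v r) (gfact v s) (gint v r.+1) (gint v s.+1).
move: (gfact v _) (gint v _) => f i a b x y z t b0 t0 z0 y0 x0.
by field; rewrite b0 t0 z0 y0 x0.
Qed.

End GaussianBinomial.

(** * Twisted commutators and additivity of the Serre expression *)

Section TwistedSerre.
Variables (F : fieldType) (A : nzRingType) (io : {rmorphism F -> A}).
Hypothesis ioC : forall c a, io c * a = a * io c.
Implicit Types (v t p : F) (x y z : A).

(** Scalars enter through the central map [io] because the ring of interest consists of matrices
    over an algebra, where scaling is by elements of that algebra; [io] will be [sclmx]. *)
Definition gserre v m x z : A :=
  \sum_(r < m.+1) io ((-1) ^+ r * gbin v m r) * (x ^+ r * z * x ^+ (m - r)).

Lemma gserreV v m x z : gserre v^-1 m x z = gserre v m x z.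
Proof. by apply: eq_bigr => r _; rewrite gbinV. Qed.

(** The parameter t makes induction on m possible: splitting off one twisted commutator replaces t
    by t v. The Serre expression is the case t = 1. *)
Definition tserre v t m x z : A :=
  \sum_(r < m.+1) io ((- t) ^+ r * qpascal v m r) * (x ^+ r * z * x ^+ (m - r)).

Lemma tserre0 v t x z : tserre v t 0 x z = z.
Proof. by rewrite /tserre big_ord1 /= !mulr1 mul1r rmorph1 mul1r. Qed.

Lemma gserreE v m x z : v != 0 -> (forall k : nat, v ^+ k = 1 -> k = 0%N) ->
  gserre v m x z = tserre v 1 m x z.
Proof.
by move=> v0 v_gen; apply: eq_bigr => r _; rewrite gbinE // -ltnS.
Qed.

(* Hence [tserre v 1 m x z] is obtained from z by applying the twisted commutators
   [w => w * x - v ^ (m - 1 - 2 * s) * (x * w)] for s = 0, ..., m - 1. *)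
Lemma tserreS v t m x z : v != 0 ->
  tserre v t m.+1 x z = tserre v (t * v) m x z * x
    - io (t * v ^- m) * (x * tserre v (t * v) m x z).
Proof.
move=> v0; rewrite /tserre mulr_suml !mulr_sumr.
rewrite [X in X - _](_ : _ = \sum_(r < m.+2) io ((- (t * v)) ^+ r * qpascal v m r)
    * (x ^+ r * z * x ^+ (m.+1 - r))); last first.
  rewrite [RHS]big_ord_recr /= qpascal_small // mulr0 rmorph0 mul0r addr0.
  apply: eq_bigr => r _; rewrite -!mulrA -exprSr subSn // -ltnS.
  exact: ltn_ord.
rewrite big_ord_recl [X in _ = X - _]big_ord_recl -addrA; congr (_ + _).
rewrite -sumrB; apply: eq_bigr => r _.
rewrite lift0 /= subSS; set w := x ^+ _ * z * _.
have -> : x * (io ((- (t * v)) ^+ r * qpascal v m r) * (x ^+ r * z * x ^+ (m - r)))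
    = io ((- (t * v)) ^+ r * qpascal v m r) * w.
  by rewrite !mulrA -ioC /w exprS !mulrA.
rewrite mulrA -mulrBl -rmorphM -rmorphB; congr (io _ * w).
have -> : v ^- (m - r) = v ^+ r * v ^- m.
  have : (r <= m)%N by rewrite -ltnS.
  move: (nat_of_ord r) => s le_sm.
  by rewrite -[in RHS](subnK le_sm) exprD invfM mulrCA mulfV ?mulr1 ?expf_neq0.
by rewrite !exprS -mulNr exprMn; ring.
Qed.

Lemma qcommM c d y a b : y * a = io c * (a * y) -> y * b = io d * (b * y) ->
  y * (a * b) = io (c * d) * (a * b * y).
Proof.
move=> ya yb; rewrite mulrA ya -mulrA -[a * y * b]mulrA yb [a * _]mulrA -ioC.
by rewrite rmorphM !mulrA.
Qed.

Lemma tserre_qcomm v t p m x y z : v != 0 ->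
  y * x = io (v ^+ 2) * (x * y) -> y * z = io p * (z * y) ->
  y * tserre v t m x z = io (p * v ^+ (2 * m)) * (tserre v t m x z * y).
Proof.
move=> v0 yx yz; elim: m t => [|m IH] t.
  by rewrite !tserre0 muln0 expr0 mulr1.
rewrite tserreS // mulrBr (qcommM (IH _) yx) [y * (io _ * _)]mulrA -[y * io _]ioC
  -[io _ * y * _]mulrA (qcommM yx (IH _)).
rewrite mulrBl mulrBr -!mulrA [io (t * _) * (io _ * _)]mulrA -rmorphM.
rewrite [io (p * _) * (io _ * _)]mulrA -rmorphM mulnS exprD.
by congr (io _ * _ - io _ * _); ring.
Qed.

(* After s steps the weight of [w] makes y commute with it up to exactly the twist
   of the next commutator, so that y never contributes. *)
Lemma tserre_addl v t p m x y z : v != 0 ->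
  y * x = io (v ^+ 2) * (x * y) -> y * z = io p * (z * y) ->
  t * p * v ^+ m = v -> tserre v t m (x + y) z = tserre v t m x z.
Proof.
move=> v0 yx yz; elim: m t => [|m IH] t tp; first by rewrite !tserre0.
rewrite !tserreS // IH; last by rewrite -[RHS]tp exprS; ring.
rewrite mulrDr mulrDl (@tserre_qcomm _ _ p _ x y) // mulrDr.
rewrite [io (t * v ^- m) * (io _ * _)]mulrA -rmorphM.
have -> : t * v ^- m * (p * v ^+ (2 * m)) = 1.
  rewrite -[RHS](_ : t * p * v ^+ m = 1); last first.
    by apply: (mulfI v0); rewrite mulr1 -[RHS]tp exprS; ring.
  rewrite mulnC exprM expr2; have := expf_neq0 m v0; move: (v ^+ m) => a a0.
  by field.
by rewrite rmorph1 mul1r opprD addrACA subrr addr0.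
Qed.

(** By linearity in the last argument there are two terms to treat. With x2 in the middle, y1 drops
    out by [tserre_addl]; with y2 in the middle, x1 does. The condition on p is q^(alpha_i, alpha_j)
    q_i^(1 - a_ij) = q_i in the application. *)
Lemma gserre_skew v p m x1 y1 x2 y2 :
  v != 0 -> (forall k : nat, v ^+ k = 1 -> k = 0%N) -> p * v ^+ m = v ->
  y1 * x1 = io (v ^+ 2) * (x1 * y1) -> y1 * x2 = io p * (x2 * y1) ->
  y2 * x1 = io p * (x1 * y2) ->
  gserre v m (x1 + y1) (x2 + y2) = gserre v m x1 x2 + gserre v m y1 y2.
Proof.
move=> v0 v_gen pv yx11 yx12 yx21.
have p0 : p != 0 by apply: contraNneq v0 => p0; rewrite -pv p0 mul0r.
have -> : gserre v m (x1 + y1) (x2 + y2)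
    = gserre v m (x1 + y1) x2 + gserre v m (x1 + y1) y2.
  by rewrite -big_split; apply: eq_bigr => r _; rewrite mulrDr mulrDl mulrDr.
congr (_ + _); first by rewrite !gserreE // (@tserre_addl _ _ p) // mul1r.
have vV0 : v^-1 != 0 by rewrite invr_eq0.
have vV_gen k : v^-1 ^+ k = 1 -> k = 0%N.
  by rewrite exprVn => /eqP; rewrite invr_eq1 => /eqP /v_gen.
have ioV c a b : c != 0 -> a = io c * b -> b = io c^-1 * a.
  by move=> c0 ->; rewrite mulrA -rmorphM mulVf // rmorph1 mul1r.
(* Seen from x1, the constants are v^-2 and p^-1, so [tserre_addl] applies with v^-1 in place of
   v. *)
rewrite addrC -gserreV -[RHS]gserreV !gserreE // (@tserre_addl _ _ p^-1) //.
- by rewrite exprVn; apply: ioV yx11; rewrite expf_neq0.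
- exact: ioV yx21.
- by rewrite mul1r exprVn -invfM pv.
Qed.

Lemma gserre_scale v m a1 a2 x1 x2 :
  GRing.comm a1 x1 -> GRing.comm a1 x2 -> GRing.comm a2 x1 -> GRing.comm a1 a2 ->
  gserre v m (a1 * x1) (a2 * x2) = a1 ^+ m * a2 * gserre v m x1 x2.
Proof.
move=> C11 C12 C21 Ca; rewrite mulr_sumr; apply: eq_bigr => r _.
rewrite [RHS]mulrA -[_ * io _]ioC -[RHS]mulrA; congr (_ * _).
have : (r <= m)%N by rewrite -ltnS.
move: (nat_of_ord r) => r' le_sm.
rewrite !exprMn_comm // -[in RHS](subnKC le_sm) exprD -!mulrA; congr (_ * _).
rewrite subnKC //.
rewrite ![x1 ^+ r' * (_ * _)]mulrA.
have -> : x1 ^+ r' * a2 = a2 * x1 ^+ r' by apply/commr_sym/commrX.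
have Cw : GRing.comm (a1 ^+ (m - r')) (x1 ^+ r' * x2).
  by apply/commr_sym/commrX/commr_sym; apply: commrM => //; apply: commrX.
have Ca' : GRing.comm (a1 ^+ (m - r')) a2 by apply/commr_sym/commrX/commr_sym.
rewrite -!mulrA [x2 * _]mulrA [x1 ^+ r' * _]mulrA [x1 ^+ r' * (x2 * _)]mulrA -Cw.
by rewrite !mulrA -Ca'.
Qed.

(** Moving b to the left past a monomial costs a1 for each x1 and a2 for x2, the same a1^m a2 every
    time. With b the degree 0 part of L^+ and a1, a2 the K's, this is where K_theta arises. *)
Lemma gserre_twist v m a1 a2 x1 x2 b :
  GRing.comm a1 x1 -> GRing.comm a1 x2 -> GRing.comm a2 x1 -> GRing.comm a1 a2 ->
  x1 * b = a1 * b * x1 -> x2 * b = a2 * b * x2 ->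
  gserre v m x1 x2 * b = a1 ^+ m * a2 * b * gserre v m x1 x2.
Proof.
move=> C11 C12 C21 Ca xb1 xb2.
have twM a a' x x' : GRing.comm a' x -> x * b = a * b * x -> x' * b = a' * b * x' ->
    (x * x') * b = (a' * a) * b * (x * x').
  by move=> C xb xb'; rewrite -mulrA xb' !mulrA -C -[a' * x * b]mulrA xb !mulrA.
have twX k : x1 ^+ k * b = a1 ^+ k * b * x1 ^+ k.
  elim: k => [|k IH]; first by rewrite !expr0 !mul1r mulr1.
  rewrite [x1 ^+ _]exprSr [a1 ^+ _]exprS; apply: (twM) => //.
  exact: commrX.
rewrite mulr_suml mulr_sumr; apply: eq_bigr => r _.
rewrite -mulrA [RHS]mulrA -[_ * io _]ioC -[RHS]mulrA; congr (_ * _).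
have : (r <= m)%N by rewrite -ltnS.
move: (nat_of_ord r) => s le_sm.
have Cs k l : GRing.comm (a1 ^+ k) (x1 ^+ l).
  by apply: commrX; apply/commr_sym/commrX/commr_sym.
have C12s k : GRing.comm (a1 ^+ k) x2 by apply/commr_sym/commrX/commr_sym.
rewrite (twM (a2 * a1 ^+ s) (a1 ^+ (m - s))) //; first last.
- by apply: (twM) => //; apply: commrX.
- by apply: commrM.
congr (_ * _ * _).
by rewrite [a2 * _](commrX _ (commr_sym Ca)) mulrA -exprD subnK.
Qed.

Lemma gserre_intertwine v m x1 x2 y1 y2 b :
  x1 * b = b * y1 -> x2 * b = b * y2 -> gserre v m x1 x2 * b = b * gserre v m y1 y2.
Proof.
move=> xb1 xb2; have xbX k : x1 ^+ k * b = b * y1 ^+ k.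
  elim: k => [|k IH]; first by rewrite !expr0 mul1r mulr1.
  by rewrite !exprS -mulrA IH mulrA xb1 mulrA.
rewrite mulr_suml mulr_sumr; apply: eq_bigr => r _.
rewrite -mulrA [RHS]mulrA -[b * io _]ioC -[RHS]mulrA; congr (_ * _).
by rewrite -[LHS]mulrA xbX mulrA -[x1 ^+ r * x2 * b]mulrA xb2 mulrA xbX !mulrA.
Qed.

End TwistedSerre.

Lemma gserre_rmorph (F : fieldType) (A0 : lalgType F) (A : nzRingType)
    (io : {rmorphism F -> A}) (j : {rmorphism A0 -> A}) v m x y :
  (forall c z, j (c *: z) = io c * j z) ->
  j (\sum_(r < m.+1) ((-1) ^+ r * gbin v m r) *: (x ^+ r * y * x ^+ (m - r))) =
  gserre io v m (j x) (j y).
Proof.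
move=> jZ; rewrite rmorph_sum; apply: eq_bigr => r _.
by rewrite jZ !rmorphM !rmorphXn.
Qed.

Lemma qbin_gbin v m r : qbin v m r = gbin v m r.
Proof.
have qfactE k : qfact v k = gfact v k by apply: eq_bigr => j _; rewrite /qint /gint.
by rewrite /qbin !qfactE.
Qed.

Lemma qserre_rmorph (A0 : algType Qq) (A : nzRingType) (io : {rmorphism Qq -> A})
    (j : {rmorphism A0 -> A}) v m x y :
  (forall c z, j (c *: z) = io c * j z) ->
  j (qserre v m x y) = gserre io v m (j x) (j y).
Proof.
move=> jZ; have -> : qserre v m x y =
    \sum_(r < m.+1) ((-1) ^+ r * gbin v m r) *: (x ^+ r * y * x ^+ (m - r)).
  by apply: eq_bigr => r _; rewrite qbin_gbin.
exact: gserre_rmorph.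
Qed.

(** * Weight components of matrices *)

Section WeightComponents.
Variables (P : zmodType) (C : P -> Prop) (A : pzRingType) (m : nat).
Variable w : 'I_m -> P.
Implicit Types S T : 'M[A]_m.

(** [deg_comp] with the degree taken in the weight group. Leaving the weight function abstract
    allows negated weights, for which the F_i become raising operators. *)
Definition wcomp b T : 'M[A]_m :=
  \matrix_(k, l) (if w k == w l + b then T k l else 0).

Definition wsupp T : Prop := forall k l, ~ C (w k - w l) -> T k l = 0.

(** Indecomposability of a in the cone C. It holds for 0 and the simple roots, and confines the
    degree a part of a product to degrees 0 and a of its factors. *)
Definition cone_min (a : P) : Prop :=
  forall x y, C x -> C y -> x + y = a -> x = 0 \/ y = 0.

Lemma wcompP T b : (forall k l, T k l != 0 -> w k = w l + b) -> wcomp b T = T.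
Proof.
move=> Tb; apply/matrixP => k l; rewrite !mxE; case: eqP => // nkl.
by apply/esym/eqP; apply/negPn/negP => /Tb.
Qed.

Lemma wcompM_0l S T b : wcomp 0 S = S -> wcomp b (S *m T) = S *m wcomp b T.
Proof.
move=> S0; apply/matrixP => k l; rewrite !mxE.
rewrite (_ : (if _ then _ else _) = \sum_j (if w k == w l + b then S k j * T j l else 0)).
  apply: eq_bigr => j _; rewrite mxE -S0 mxE addr0.
  by case: (w k =P w j) => [->|_]; rewrite ?mul0r ?if_same //; case: ifP; rewrite ?mulr0.
by case: eqP => // _; rewrite big1.
Qed.

Lemma wcompM_0r S T b : wcomp 0 T = T -> wcomp b (S *m T) = wcomp b S *m T.
Proof.
move=> T0; apply/matrixP => k l; rewrite !mxE.
rewrite (_ : (if _ then _ else _) = \sum_j (if w k == w l + b then S k j * T j l else 0)).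
  apply: eq_bigr => j _; rewrite mxE -T0 mxE addr0.
  by case: (w j =P w l) => [->|_]; rewrite ?mulr0 ?if_same //; case: ifP; rewrite ?mul0r.
by case: eqP => // _; rewrite big1.
Qed.

Lemma wcompM S T a : a != 0 -> cone_min a -> wsupp S -> wsupp T ->
  wcomp a (S *m T) = wcomp a S *m wcomp 0 T + wcomp 0 S *m wcomp a T.
Proof.
move=> a0 amin suppS suppT; apply/matrixP => k l; rewrite !mxE -big_split /=.
rewrite (_ : (if _ then _ else _) = \sum_j (if w k == w l + a then S k j * T j l else 0));
  last by case: eqP => // _; rewrite big1.
apply: eq_bigr => j _; rewrite !mxE !addr0.
have na x : (x == x + a) = false by rewrite -subr_eq0 opprD addNKr oppr_eq0 (negPf a0).
case: (w k =P w j) => kj; case: (w j =P w l) => jl.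
- by rewrite kj jl na mul0r mulr0 addr0.
- by rewrite kj na mulr0 add0r; case: ifP => _; rewrite ?mulr0.
- by rewrite jl na mulr0 addr0; case: ifP => _; rewrite ?mul0r.
(* An intermediate weight different from both ends would decompose a inside the cone. *)
rewrite mulr0 mul0r addr0; case: eqP => // kl.
have [Ckj|/suppS ->] := pselect (C (w k - w j)); last by rewrite mul0r.
have [Cjl|/suppT ->] := pselect (C (w j - w l)); last by rewrite mulr0.
case: (amin _ _ Ckj Cjl); first by rewrite addrA subrK kl addrAC subrr add0r.
- by move/subr0_eq.
- by move/subr0_eq.
Qed.

Lemma wcompM0 S T : cone_min 0 -> wsupp S -> wsupp T ->
  wcomp 0 (S *m T) = wcomp 0 S *m wcomp 0 T.
Proof.
move=> min0 suppS suppT; apply/matrixP => k l; rewrite !mxE.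
rewrite (_ : (if _ then _ else _) = \sum_j (if w k == w l + 0 then S k j * T j l else 0));
  last by case: eqP => // _; rewrite big1.
apply: eq_bigr => j _; rewrite !mxE !addr0.
case: (w k =P w j) => kj; first by rewrite kj; case: ifP => _; rewrite ?mulr0.
rewrite mul0r; case: eqP => // kl.
have [Ckj|/suppS ->] := pselect (C (w k - w j)); last by rewrite mul0r.
have [Cjl|/suppT ->] := pselect (C (w j - w l)); last by rewrite mulr0.
have eq0 : w k - w j + (w j - w l) = 0 by rewrite addrA subrK kl subrr.
case: (min0 _ _ Ckj Cjl eq0) => [/subr0_eq //|jl].
by case: kj; move: eq0; rewrite jl addr0 => /subr0_eq.
Qed.

Lemma wcomp0_idem T : wcomp 0 (wcomp 0 T) = wcomp 0 T.
Proof. by apply/matrixP => k l; rewrite !mxE addr0; case: eqP. Qed.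

Lemma wcompD b S T : wcomp b (S + T) = wcomp b S + wcomp b T.
Proof. by apply/matrixP => k l; rewrite !mxE; case: ifP; rewrite ?addr0. Qed.

Lemma wcomp_scalar b c : b != 0 -> wcomp b c%:M = 0.
Proof.
move=> b0; apply/matrixP => k l; rewrite !mxE; case: (k =P l) => [->|].
  by rewrite -subr_eq0 opprD addNKr oppr_eq0 (negPf b0).
by rewrite mulr0n if_same.
Qed.

Lemma wcomp0_scalar c : wcomp 0 c%:M = c%:M.
Proof.
apply/matrixP => k l; rewrite !mxE addr0; case: (k =P l) => [->|]; first by rewrite eqxx.
by rewrite mulr0n if_same.
Qed.

Lemma wcomp0_diag d : wcomp 0 (diag_mx d) = diag_mx d.
Proof.
apply/matrixP => k l; rewrite !mxE addr0; case: (k =P l) => [->|]; first by rewrite eqxx.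
by rewrite mulr0n if_same.
Qed.

End WeightComponents.

(** * Roots and weights *)

Section LieLemmas.
Variables (n : nat) (g : simple_datum n).
Implicit Types (b c : 'rV[int]_n) (mu : 'rV[int]_n).

Lemma root_weightD b c : root_weight g (b + c) = root_weight g b + root_weight g c.
Proof.
apply/rowP => i; rewrite !mxE -big_split; apply: eq_bigr => j _.
by rewrite mxE mulrDr.
Qed.

Lemma root_weight0 : root_weight g 0 = 0.
Proof. by apply: (addrI (root_weight g 0)); rewrite -root_weightD !addr0. Qed.

Lemma root_weightN b : root_weight g (- b) = - root_weight g b.
Proof.
by apply: (addrI (root_weight g b)); rewrite -root_weightD !subrr root_weight0.
Qed.

Lemma root_formC b c : root_form g b c = root_form g c b.
Proof.
rewrite /root_form exchange_big; apply: eq_bigr => i _; apply: eq_bigr => j _.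
by rewrite cartan_sym; ring.
Qed.

Lemma weight_root_form_root b c :
  weight_root_form g (root_weight g b) c = root_form g b c.
Proof.
rewrite root_formC; apply: eq_bigr => i _; rewrite mxE 2!mulr_suml.
by apply: eq_bigr => j _; ring.
Qed.

Lemma weight_root_formDl mu nu b : weight_root_form g (mu + nu) b =
  weight_root_form g mu b + weight_root_form g nu b.
Proof.
by rewrite /weight_root_form -big_split; apply: eq_bigr => i _; rewrite mxE !mulrDl.
Qed.

Lemma weight_root_formDr mu b c : weight_root_form g mu (b + c) =
  weight_root_form g mu b + weight_root_form g mu c.
Proof.
by rewrite /weight_root_form -big_split; apply: eq_bigr => i _; rewrite mxE mulrDr.
Qed.

Lemma weight_root_formNr mu b :
  weight_root_form g mu (- b) = - weight_root_form g mu b.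
Proof.
by rewrite /weight_root_form -sumrN; apply: eq_bigr => i _; rewrite mxE mulrN.
Qed.

Lemma weight_root_form0 mu : weight_root_form g mu 0 = 0.
Proof.
by rewrite -(subrr (0 : 'rV[int]_n)) weight_root_formDr weight_root_formNr subrr.
Qed.

Lemma root_formNl b c : root_form g (- b) c = - root_form g b c.
Proof.
by rewrite root_formC -weight_root_form_root weight_root_formNr
  weight_root_form_root root_formC.
Qed.

Lemma weight_root_form_sroot mu i :
  weight_root_form g mu (sroot i) = mu 0 i * (dlen g i)%:Z.
Proof.
rewrite /weight_root_form (bigD1 i) //= big1 => [|j ji].
  by rewrite mxE !eqxx mulr1 addr0.
by rewrite mxE (negPf ji) mulr0.
Qed.

Lemma weight_root_form_inj mu nu :
  (forall b, weight_root_form g mu b = weight_root_form g nu b) -> mu = nu.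
Proof.
move=> eq_mn; apply/rowP => i; have := eq_mn (sroot i).
rewrite !weight_root_form_sroot; apply: mulIf.
by rewrite eqz_nat -lt0n dlen_gt0.
Qed.

Lemma root_form_eq0 b : root_form g b b = 0 -> b = 0.
Proof.
move=> bb; apply/eqP/negPn/negP => /(cartan_posdef g).
by rewrite -/(root_form g b b) bb.
Qed.

Lemma root_weight_eq0 b : root_weight g b = 0 -> b = 0.
Proof.
move=> b0; apply: root_form_eq0; rewrite -weight_root_form_root b0.
by rewrite /weight_root_form big1 // => i _; rewrite mxE !mul0r.
Qed.

Lemma root_weight_inj : injective (root_weight g).
Proof.
move=> b c bc; apply/eqP; rewrite -subr_eq0; apply/eqP/root_weight_eq0.
by rewrite root_weightD root_weightN bc subrr.
Qed.

Definition pos_cone mu : Prop := exists2 b, Qplus b & mu = root_weight g b.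

Lemma pos_cone0 : pos_cone 0.
Proof. by exists 0; rewrite ?root_weight0 // => i; rewrite mxE. Qed.

Lemma sroot_neq0 i : sroot i != 0 :> 'rV[int]_n.
Proof. by apply/eqP => /rowP /(_ i); rewrite !mxE !eqxx. Qed.

Lemma Qplus_sroot i : Qplus (sroot i : 'rV[int]_n).
Proof. by move=> j; rewrite mxE. Qed.

Lemma pos_coneD mu nu : pos_cone mu -> pos_cone nu -> pos_cone (mu + nu).
Proof.
move=> [b b0 ->] [c c0 ->]; exists (b + c); rewrite ?root_weightD // => i.
by rewrite mxE addr_ge0.
Qed.

Lemma pos_cone_min0 : cone_min pos_cone 0.
Proof.
move=> _ _ [b b0 ->] [c c0 ->] /eqP; rewrite -root_weightD => /eqP /root_weight_eq0 bc.
left; rewrite (_ : b = 0) ?root_weight0 //; apply/rowP => i; apply: le_anti.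
rewrite mxE b0 andbT; move/rowP/(_ i): bc; rewrite !mxE => /eqP.
by rewrite addr_eq0 => /eqP ->; rewrite oppr_le0.
Qed.

Lemma pos_cone_min_sroot i : cone_min pos_cone (root_weight g (sroot i)).
Proof.
move=> _ _ [b b0 ->] [c c0 ->] /eqP; rewrite -root_weightD => /eqP /root_weight_inj bc.
have bcj j : j != i -> b 0 j = 0 /\ c 0 j = 0.
  move=> ji; move/rowP/(_ j): bc; rewrite !mxE (negPf ji) /= => /eqP.
  by rewrite paddr_eq0 // => /andP[/eqP -> /eqP ->].
have bci : b 0 i + c 0 i = 1 by move/rowP/(_ i): bc; rewrite !mxE !eqxx.
have eq0 (d : 'rV[int]_n) : (forall j, j != i -> d 0 j = 0) -> d 0 i = 0 -> root_weight g d = 0.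
  move=> d0 di; rewrite (_ : d = 0) ?root_weight0 //; apply/rowP => j; rewrite mxE.
  by have [->|/d0] := eqVneq j i.
have [bi|bi] := eqVneq (b 0 i) 0; [left|right]; apply: eq0 => //.
- by move=> j /bcj [].
- by move=> j /bcj [].
- have : 1 <= b 0 i by rewrite -gtz0_ge1 lt_def bi b0.
  move=> b1; apply: le_anti; rewrite c0 andbT -(lerD2l (b 0 i)) bci addr0 //.
Qed.

(** The matrix has integer entries, so a vanishing determinant yields an integral kernel vector, on
    which the form would be 0 against [cartan_posdef]. *)
Lemma sroot_gram_unit : sroot_gram g \in unitmx.
Proof.
have -> : sroot_gram g = map_mx intr (\matrix_(i, j) ((dlen g i)%:Z * cartan g i j)).
  by apply/matrixP => i j; rewrite !mxE rmorphM.
rewrite unitmxE det_map_mx unitfE intr_eq0; apply/det0P => -[b b0 bG].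
have := cartan_posdef g b0; rewrite (_ : \sum_i _ = (b *m \matrix_(i, j)
    ((dlen g i)%:Z * cartan g i j) *m b^T) 0 0); first by rewrite bG mul0mx mxE.
rewrite mxE exchange_big; apply: eq_bigr => j _.
by rewrite !mxE mulr_suml; apply: eq_bigr => i _; rewrite mxE.
Qed.

(** With A the Cartan matrix and C = D A the Gram matrix, (D C^-1 D) A = D. So pairings with roots
    are integers although the form on weights is rational. *)
Lemma weight_form_root mu b :
  weight_form g mu (root_weight g b) = (weight_root_form g mu b)%:~R.
Proof.
have rwE : (map_mx intr (root_weight g b))^T =
    map_mx intr (cartan g) *m (map_mx intr b)^T :> 'cV[rat]_n.
  apply/colP => i; rewrite !mxE rmorph_sum; apply: eq_bigr => j _.
  by rewrite !mxE rmorphM.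
have gramE : sroot_gram g = dlen_mx g *m map_mx intr (cartan g).
  by apply/matrixP => i j; rewrite mul_diag_mx !mxE.
rewrite /weight_form rwE -!mulmxA [dlen_mx g *m (map_mx _ _ *m _)]mulmxA -gramE.
rewrite mulKmx ?sroot_gram_unit // !mxE rmorph_sum; apply: eq_bigr => i _.
by rewrite mul_diag_mx !mxE !rmorphM mulrA.
Qed.

Lemma weight_formC mu nu : weight_form g mu nu = weight_form g nu mu.
Proof.
rewrite /weight_form; set G := dlen_mx g *m _ *m _.
have GT : G^T = G.
  rewrite /G /dlen_mx !trmx_mul trmx_inv !tr_diag_mx mulmxA.
  suff -> : (sroot_gram g)^T = sroot_gram g by [].
  apply/matrixP => i j; rewrite !mxE.
  have := congr1 (fun z : int => z%:~R : rat) (cartan_sym g i j).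
  by rewrite !rmorphM.
move: G GT => G GT.
have -> : map_mx intr mu *m G *m (map_mx intr nu)^T =
    (map_mx intr nu *m G *m (map_mx intr mu)^T)^T.
  by rewrite !trmx_mul GT trmxK mulmxA.
by rewrite !mxE.
Qed.

Lemma weight_formDr mu nu nu' :
  weight_form g mu (nu + nu') = weight_form g mu nu + weight_form g mu nu'.
Proof. by rewrite /weight_form map_mxD linearD mulmxDr mxE. Qed.

End LieLemmas.

(** * The module and the R-matrix *)

Section FiniteSums.
Variables (T : choiceType) (p : nat) (W : set T) (f : T -> 'M[Qq]_p).
Hypothesis f_supp : exists s : seq T, forall x, W x -> f x != 0 -> x \in s.

(** A sum over a set takes a default value when its support is infinite; the bound [f_supp] is what
    allows it to be expanded. *)
Lemma fsum_mx_seq : exists r : seq T, [/\ uniq r, forall x, x \in r -> W x,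
  forall x, W x -> x \notin r -> f x = 0 & \sum_(x \in W) f x = \sum_(x <- r) f x].
Proof.
have [s fs] := f_supp; pose r := undup [seq x <- s | `[< W x >]].
have rW x : x \in r -> W x by rewrite mem_undup mem_filter => /andP[/asboolP].
have fr x : W x -> x \notin r -> f x = 0.
  move=> Wx; rewrite mem_undup mem_filter negb_and => /orP[/asboolP //|xs].
  by apply/eqP/negPn/negP => /(fs _ Wx); apply/negP.
exists r; split=> //; first exact: undup_uniq.
rewrite (fsbigE r) ?undup_uniq //.
rewrite big_seq_cond [RHS]big_seq; apply: eq_bigl => x.
by case: (boolP (x \in r)) => //= /rW Wx; rewrite mem_set.
Qed.

Lemma fsum_mx_entry a k l : W a -> (forall x, W x -> x != a -> f x k l = 0) ->
  (\sum_(x \in W) f x) k l = f a k l.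
Proof.
move=> Wa fa; have [r [r_uniq rW fr ->]] := fsum_mx_seq; rewrite summxE.
have [ar|/(fr _ Wa) fa0] := boolP (a \in r).
  rewrite (bigD1_seq a) //= big_seq_cond big1 ?addr0 // => x /andP[/rW Wx].
  exact: fa.
rewrite fa0 mxE big_seq big1 // => x /rW Wx.
by have [->|/fa ->] := eqVneq x a; rewrite ?fa0 ?mxE.
Qed.

Lemma fsum_mx_entry0 k l : (forall x, W x -> f x k l = 0) ->
  (\sum_(x \in W) f x) k l = 0.
Proof.
move=> f0; have [r [r_uniq rW fr ->]] := fsum_mx_seq; rewrite summxE.
by rewrite big_seq big1 // => x /rW /f0.
Qed.

End FiniteSums.

Section Generators.
Variables (n : nat) (g : simple_datum n).

Lemma Uq_deg_E i : Uq_deg (sroot i) (Eg g i).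
Proof.
move=> mu; rewrite root_formC /Eg /Kg -!(rmorphM (quot_pi _)) -(linearZZ (quot_pi _)).
exact: (@quot_pi_eq _ _ (Relators (@Uq_proper n g)) _ _ (Uq_KE g mu i)).
Qed.

Lemma Uq_deg_F i : Uq_deg (- sroot i) (Fg g i).
Proof.
move=> mu; rewrite root_formC -weight_root_form_root weight_root_formNr.
rewrite weight_root_form_root /Fg /Kg -!(rmorphM (quot_pi _)).
rewrite -(linearZZ (quot_pi _)).
exact: (@quot_pi_eq _ _ (Relators (@Uq_proper n g)) _ _ (Uq_KF g mu i)).
Qed.

Lemma Uq_commEF i : Eg g i * Fg g i - Fg g i * Eg g i =
  (qi g i - (qi g i)^-1)^-1 *: (Kg g (sroot i) - Kg g (- sroot i)).
Proof.
rewrite /Eg /Fg /Kg -!(rmorphM (quot_pi _)) -!(rmorphB (quot_pi _)).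
rewrite -(linearZZ (quot_pi _)).
have := @quot_pi_eq _ _ (Relators (@Uq_proper n g)) _ _ (Uq_EF g i i).
by rewrite eqxx div1r.
Qed.

Lemma Uq_serre_F i j : i != j ->
  qserre (qi g i) (serre_deg g i j) (Fg g i) (Fg g j) = 0.
Proof.
move=> ij; rewrite -(rmorph_qserre (quot_pi (Relators (@Uq_proper n g)))).
by apply: quot_pi0; apply: ideal_gen; exact: Uq_serreF.
Qed.

Lemma qi_neq0 i : qi g i != 0.
Proof. by rewrite expf_neq0 // qv_neq0. Qed.

Lemma qi_generic i (k : nat) : qi g i ^+ k = 1 -> k = 0%N.
Proof.
rewrite -exprM => /(qv_expz_eq1 (z := (_ * _)%N%:Z)) /eqP.
by rewrite eqz_nat muln_eq0 eqn0Ngt dlen_gt0 => /eqP.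
Qed.

Lemma qi_subV_neq0 i : qi g i - (qi g i)^-1 != 0.
Proof.
apply/eqP => /eqP; rewrite subr_eq0 => /eqP qV.
suff /qi_generic : qi g i ^+ 2 = 1 by [].
by rewrite expr2 {2}qV mulfV // qi_neq0.
Qed.

End Generators.

(** * Weights of V and the action of the generators *)

Section ModuleLemmas.
Variables (n : nat) (g : simple_datum n) (N : nat).
Variables (pi : {lrmorphism Uq g -> 'M[Qq]_N.+1}) (wt : 'I_N.+1 -> 'rV[int]_n).
Variable lam : 'rV[int]_n.
Hypothesis irr : is_irr_module pi wt lam.
Implicit Types (b nu : 'rV[int]_n) (k l : 'I_N.+1).

Lemma pi_Kg b : pi (Kg g b) = diag_mx (\row_k qv ^ weight_root_form g (wt k) b).
Proof.
apply/matrixP => k l; have /matrixP/(_ k 0) := irr_basis irr l b.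
rewrite -colE !mxE => ->; case: (k =P l) => [->|_]; first by rewrite mulr1.
by rewrite mulr0.
Qed.

(** Conjugating by K_mu multiplies the entry (k, l) by q^(wt k - wt l, mu); q is not a root of unity
    and the pairing with the root lattice separates weights. *)
Lemma pi_deg b x k l : Uq_deg b x -> pi x k l != 0 -> wt k = wt l + root_weight g b.
Proof.
move=> xb xkl; apply: (weight_root_form_inj (g := g)) => mu.
have /(congr1 pi) := xb mu.
rewrite (rmorphM pi) (rmorphM pi (Kg g mu) x) linearZZ /= -!mulmxE !pi_Kg.
move/matrixP/(_ k l); rewrite mul_mx_diag mxE mul_diag_mx !mxE.
rewrite mulrC mulrA => /(mulIf xkl).
rewrite -expfzDr ?qv_neq0 // => /qv_expz_inj /eqP.
rewrite weight_root_formNr addrC subr_eq weight_root_formDl weight_root_form_root.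
by rewrite addrC => /eqP.
Qed.


Lemma pi_E i k l : pi (Eg g i) k l != 0 -> wt k = wt l + root_weight g (sroot i).
Proof. by apply: pi_deg; exact: Uq_deg_E. Qed.

Lemma pi_F i k l : pi (Fg g i) k l != 0 -> wt k = wt l - root_weight g (sroot i).
Proof. by rewrite -root_weightN; apply: pi_deg; exact: Uq_deg_F. Qed.

(* Without this [is_X] would put no condition on X_i. *)
Lemma pi_E_neq0 i : lam != 0 -> pi (Eg g i) != 0.
Proof.
move=> lam0; apply/negP => Ei0.
(* If E_j acts by 0, so does [E_j, F_j], whence K_j = K_j^-1 and every weight is orthogonal to
   alpha_j. *)
have wt0 j : pi (Eg g j) = 0 -> forall k, wt k 0 j = 0.
  move=> Ej0 k; have /(congr1 pi) := Uq_commEF g j.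
  rewrite (rmorphB pi) (rmorphM pi (Eg g j)) (rmorphM pi (Fg g j)) linearZZ.
  rewrite (rmorphB pi (Kg g _)) /= Ej0 mul0r mulr0 subrr !pi_Kg.
  move/matrixP/(_ k k); rewrite !mxE eqxx !mulr1n => /esym/eqP.
  rewrite mulf_eq0 invr_eq0 (negPf (qi_subV_neq0 g j)) /= subr_eq0 => /eqP.
  move/qv_expz_inj/eqP; rewrite weight_root_formNr weight_root_form_sroot.
  rewrite -subr_eq0 opprK -mulr2n mulrn_eq0 /= mulf_eq0 eqz_nat.
  by rewrite eqn0Ngt dlen_gt0 orbF => /eqP.
(* If J is everything, all weights vanish, lam included. Otherwise some alpha_j' with j' outside J
   is not orthogonal to some alpha_j with j in J, yet it is a difference of two weights, both
   orthogonal to alpha_j. *)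
pose J := [set j | pi (Eg g j) == 0]%SET.
have J0 : J != finset.set0 by apply/finset.set0Pn; exists i; rewrite finset.inE.
have [JT|/(cartan_irr g J0) [j [j' [jJ j'J]]]] := eqVneq J finset.setT.
  have [w [w0 w_lam _]] := irr_highest irr.
  have [k wk] : exists k, w k 0 != 0 by apply/cV0Pn.
  suff lam_k : lam = wt k.
    move/eqP: lam0; apply; rewrite lam_k; apply/rowP => j; rewrite mxE.
    by apply: wt0; apply/eqP; have := finset.in_setT j; rewrite -JT finset.inE.
  apply: (weight_root_form_inj (g := g)) => b; apply: qv_expz_inj.
  have /matrixP/(_ k 0) := w_lam b; rewrite pi_Kg mul_diag_mx !mxE.
  by move/(mulIf wk) ->.
move/eqP; apply; rewrite !finset.inE in jJ j'J.
have [k [l kl]] : exists k l, pi (Eg g j') k l != 0.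
  by move/matrix0Pn: j'J => [k [l kl]]; exists k, l.
have /rowP/(_ j) := pi_E kl; rewrite mxE !(wt0 j) ?(eqP jJ) // add0r mxE.
rewrite (bigD1 j') //= big1 => [|k' kj']; last by rewrite mxE (negPf kj') mulr0.
by rewrite mxE !eqxx mulr1 addr0.
Qed.

(** Every simple root is a difference of weights since E_j' acts nontrivially. If theta were
    orthogonal to all weights it would be orthogonal to all roots, hence to itself, and so
    vanish. *)
Lemma exists_weight i j : lam != 0 -> i != j -> forall m : nat,
  exists k, weight_root_form g (wt k) (sroot i *+ m + sroot j) != 0.
Proof.
move=> lam0 ij m; apply/existsP; rewrite -negb_forall; apply/negP => /forallP wt0.
have rf0 j' : root_form g (sroot j') (sroot i *+ m + sroot j) = 0.
  have /matrix0Pn [k [l /pi_E kl]] := pi_E_neq0 j' lam0.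
  have /eqP := wt0 k; rewrite kl weight_root_formDl (eqP (wt0 l)) add0r.
  by rewrite weight_root_form_root.
suff /root_form_eq0/rowP/(_ j) : root_form g (sroot i *+ m + sroot j)
    (sroot i *+ m + sroot j) = 0.
  by rewrite !mxE mulmxnE !mxE !eqxx eq_sym (negPf ij) mul0rn.
rewrite -weight_root_form_root weight_root_formDr.
rewrite [X in _ + X]weight_root_form_root [root_form g _ (sroot j)]root_formC rf0 addr0.
(* Only the multiplicity in the second argument varies; theta itself stays fixed. *)
elim: {2}m => [|m' IH].
  by rewrite mulr0n weight_root_form0.
by rewrite mulrS weight_root_formDr IH weight_root_form_root root_formC rf0.
Qed.

Lemma weights_wt mu : weights pi mu -> exists k, mu = wt k.
Proof.
case=> w w_mu /cV0Pn [k wk]; exists k.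
apply: (weight_root_form_inj (g := g)) => b; apply: qv_expz_inj.
have /matrixP/(_ k 0) := w_mu b; rewrite pi_Kg mul_diag_mx !mxE.
by move/(mulIf wk) ->.
Qed.

Lemma wt_weights k : weights pi (wt k).
Proof.
exists (delta_mx k 0); first exact: (irr_basis irr).
by apply/cV0Pn; exists k; rewrite mxE !eqxx oner_neq0.
Qed.

Definition dcoef (mu nu : 'rV[int]_n) : Qq :=
  qv ^ Num.floor (weight_form g mu nu - weight_form g lam lam).

Lemma dcoef_neq0 mu nu : dcoef mu nu != 0.
Proof. exact: qv_expz_neq0. Qed.

(** The shift changes the exponent by an integer, which passes through the floor. *)
Lemma dcoefDr mu nu b : dcoef mu (nu + root_weight g b) =
  dcoef mu nu * qv ^ weight_root_form g mu b.
Proof.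
rewrite /dcoef weight_formDr weight_form_root addrAC floorDrz ?intr_int //.
by rewrite intrKfloor expfzDr // qv_neq0.
Qed.

Lemma dcoefC mu nu : dcoef mu nu = dcoef nu mu.
Proof. by rewrite /dcoef weight_formC. Qed.

Lemma Dmx_entry k k' l l' :
  Dmx pi wt lam (mxtens_index (k, k')) (mxtens_index (l, l')) =
  ((k == l) && (k' == l'))%:R * dcoef (wt k) (wt k').
Proof.
have supp (T : zmodType) (f : 'rV[int]_n -> T) : exists s : seq 'rV[int]_n,
    forall mu, weights pi mu -> f mu != 0 -> mu \in s.
  by exists (codom wt) => mu /weights_wt [k0 ->] _; exact: codom_f.
rewrite /Dmx (fsum_mx_entry (supp _ _) (a := wt k)); first last.
- move=> mu _ mu_k; apply: (fsum_mx_entry0 (supp _ _)) => nu _.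
  by rewrite mxE tensmxE !mxE [wt k == mu]eq_sym (negPf mu_k) mul0rn mul0r mulr0.
- exact: wt_weights.
rewrite (fsum_mx_entry (supp _ _) (a := wt k')); first last.
- move=> nu _ nu_k; rewrite mxE tensmxE !mxE.
  by rewrite [wt k' == nu]eq_sym (negPf nu_k) mul0rn !mulr0.
- exact: wt_weights.
rewrite mxE tensmxE !mxE !eqxx mulrC -/(dcoef _ _); congr (_ * _).
by rewrite -mulnb natrM.
Qed.

End ModuleLemmas.

(** * Components of R in first-leg degrees 0 and alpha_i *)

Section RMatrix.
Variables (n : nat) (g : simple_datum n) (N : nat).
Variables (pi : {lrmorphism Uq g -> 'M[Qq]_N.+1}) (wt : 'I_N.+1 -> 'rV[int]_n).
Variable lam : 'rV[int]_n.
Hypothesis irr : is_irr_module pi wt lam.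

(** Induction over the generation of x, so that no expansion of x into homogeneous monomials is
    required; the product case is where indecomposability of 0 and alpha_i enters. *)
Lemma gen_subalg_graded (X : 'I_n -> Uq g) (w : 'I_N.+1 -> 'rV[int]_n) i x :
  (forall j k l, pi (X j) k l != 0 -> w k = w l + root_weight g (sroot j)) ->
  gen_subalg (range X) x ->
  [/\ wsupp (pos_cone g) w (pi x), exists c, wcomp w 0 (pi x) = c%:M
    & exists c, wcomp w (root_weight g (sroot i)) (pi x) = c *: pi (X i)].
Proof.
move=> Xdeg.
have a0 j : root_weight g (sroot j) != 0.
  by apply/eqP => /root_weight_eq0/eqP; apply/negP/sroot_neq0.
elim=> {x} [_ [j _ <-]||x y _ [sx [cx x0] [dx x1]] _ [sy [cy y0] [dy y1]]
  |c x _ [sx [cx x0] [dx x1]]|x y _ [sx [cx x0] [dx x1]] _ [sy [cy y0] [dy y1]]].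
- split.
  + move=> k l nkl; apply/eqP/negPn/negP => /Xdeg kl; case: nkl.
    rewrite kl addrAC subrr add0r; exists (sroot j) => //; exact: Qplus_sroot.
  + exists 0; apply/matrixP => k l; rewrite !mxE mul0rn addr0.
    case: eqP => // kl; apply/eqP/negPn/negP => /Xdeg /eqP.
    by rewrite kl -subr_eq0 opprD addNKr oppr_eq0 (negPf (a0 j)).
  + exists (j == i)%:R; apply/matrixP => k l; rewrite !mxE.
    have [->|ji] := eqVneq j i.
      rewrite mul1r; case: eqP => // nkl.
      by apply/esym/eqP/negPn/negP => /Xdeg.
    rewrite mul0r; case: eqP => // kl; apply/eqP/negPn/negP => /Xdeg.
    rewrite kl => /addrI/root_weight_inj/rowP/(_ i); rewrite !mxE !eqxx.
    by rewrite [i == j]eq_sym (negPf ji).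
- split.
  + move=> k l; rewrite rmorph1 mxE; case: (k =P l) => [->|//].
    by rewrite subrr => /(_ (pos_cone0 g)).
  + by exists 1; rewrite (rmorph1 pi); exact: wcomp0_scalar.
  + by exists 0; rewrite (rmorph1 pi) scale0r; exact: wcomp_scalar.
- rewrite (raddfD pi); split.
  + by move=> k l kl; rewrite mxE sx // sy // addr0.
  + by exists (cx + cy); rewrite wcompD x0 y0 raddfD.
  + by exists (dx + dy); rewrite wcompD x1 y1 scalerDl.
- rewrite (linearZZ pi).
  have wZ b : wcomp w b (c *: pi x) = c *: wcomp w b (pi x).
    by apply/matrixP => k l; rewrite !mxE; case: ifP; rewrite ?mulr0.
  split.
  + by move=> k l kl; rewrite mxE sx // mulr0.
  + by exists (c * cx); rewrite wZ x0 scale_scalar_mx.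
  + by exists (c * dx); rewrite wZ x1 scalerA.
- rewrite (rmorphM pi) -mulmxE /=; split.
  + move=> k l kl; rewrite mxE big1 // => j _.
    have [kj|/sx -> //] := pselect (pos_cone g (w k - w j)); last by rewrite mul0r.
    have [jl|/sy ->] := pselect (pos_cone g (w j - w l)); last by rewrite mulr0.
    by case: kl; rewrite -(subrKA (w j)); apply: pos_coneD.
  + exists (cx * cy); rewrite (wcompM0 (@pos_cone_min0 _ g)) // x0 y0.
    by rewrite -scalar_mxM.
  + exists (dx * cy + cx * dy).
    rewrite (wcompM _ (@pos_cone_min_sroot _ g i)) // x0 y0 x1 y1.
    by rewrite mul_mx_scalar mul_scalar_mx !scalerA -scalerDl [cy * _]mulrC.
Qed.

Lemma pi_npos_sroot i x : Uq_npos x -> Uq_deg (sroot i) x ->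
  exists c, pi x = c *: pi (Eg g i).
Proof.
move=> x_pos x_deg.
have [_ _ [c xE]] := gen_subalg_graded i (pi_E irr) x_pos.
by exists c; rewrite -xE wcompP // => k l; apply: (pi_deg irr x_deg).
Qed.

Lemma pi_nneg_sroot i x : Uq_nneg x -> Uq_deg (- sroot i) x ->
  exists c, pi x = c *: pi (Fg g i).
Proof.
move=> x_neg x_deg.
(* Negating the weights makes F_j raise by alpha_j, and the lemma for the E_j applies again. *)
have F_deg j k l : pi (Fg g j) k l != 0 ->
    - wt k = - wt l + root_weight g (sroot j).
  by move=> /(pi_F irr) ->; rewrite opprB addrC.
have [_ _ [c xE]] := gen_subalg_graded i F_deg x_neg.
exists c; rewrite -xE wcompP // => k l /(pi_deg irr x_deg) ->.
by rewrite root_weightN opprB addrC.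
Qed.

Variables (Delta : {lrmorphism Uq g -> UqUq g}) (Psi : {lrmorphism UqUq g -> UqUq g}).
Variable Rp : 'rV[int]_n -> UqUq g.
Hypothesis Rplus : is_Rplus Delta Psi Rp.

Lemma pi_pi_Rplus_deg nu k k' l l' : Qplus nu ->
  pi_pi pi (Rp nu) (mxtens_index (k, k')) (mxtens_index (l, l')) != 0 ->
  wt k = wt l + root_weight g nu.
Proof.
move=> nu0; have [s [s_deg ->]] := Rplus_deg Rplus nu0.
rewrite (raddf_sum (pi_pi pi)) summxE /=; apply: contraNeq => nkl.
apply/eqP; rewrite big_seq big1 // => ab /s_deg [[_ a_deg] _].
rewrite -[tensor _ _ _]/(tensU ab.1 ab.2) pi_piE tensmxE.
suff -> : pi ab.1 k l = 0 by rewrite mul0r.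
by apply/eqP; apply: contraNT nkl => /(pi_deg irr a_deg) ->.
Qed.

Lemma pi_pi_Rplus_sroot i :
  exists c, pi_pi pi (Rp (sroot i)) = c *: (pi (Eg g i) *t pi (Fg g i)).
Proof.
have [s [s_deg ->]] := Rplus_deg Rplus (@Qplus_sroot n i).
elim: s s_deg => [|[a b] s IH] s_deg.
  by exists 0; rewrite big_nil (raddf0 (pi_pi pi)) scale0r.
have [|c cE] := IH; first by move=> ab abs; apply: s_deg; rewrite inE abs orbT.
have [[a1 a2] [b1 b2]] := s_deg (a, b) (mem_head _ _).
have [ca aE] := pi_npos_sroot a1 a2; have [cb bE] := pi_nneg_sroot b1 b2.
exists (ca * cb + c); rewrite big_cons (raddfD (pi_pi pi)) /= cE scalerDl.
congr (_ + _); rewrite -[tensor _ _ _]/(tensU a b) pi_piE aE bE.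
by apply/matrixP => k l; rewrite !mxE mulrACA.
Qed.

(** A nonzero term forces nu to be a difference of two of the finitely many weights; [h] recovers nu
    from the pair, with default value 0. *)
Lemma Rplus_supp : exists s : seq 'rV[int]_n,
  forall nu, Qplus nu -> pi_pi pi (Rp nu) != 0 -> nu \in s.
Proof.
pose h (kl : 'I_N.+1 * 'I_N.+1) : 'rV[int]_n :=
  if pselect (exists nu, wt kl.1 = wt kl.2 + root_weight g nu) is left e
  then projT1 (cid e) else 0.
exists (codom h) => nu nu0 /matrix0Pn [kk' [ll']].
case: (mxtens_indexP kk') => k k'; case: (mxtens_indexP ll') => l l'.
move=> /(pi_pi_Rplus_deg nu0) kl.
suff <- : h (k, l) = nu by exact: codom_f.
rewrite /h; case: pselect => [e|[]]; last by exists nu.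
case: cid => /= nu' kl'; apply: (@root_weight_inj _ g).
by apply: (addrI (wt l)); rewrite -kl -kl'.
Qed.

Definition mx_block (A : Type) (T : 'M[A]_(N.+1 * N.+1)) (k l : 'I_N.+1) : 'M[A]_N.+1 :=
  \matrix_(k', l') T (mxtens_index (k, k')) (mxtens_index (l, l')).

Definition Dblock k : 'M[Qq]_N.+1 := diag_mx (\row_k' dcoef g lam (wt k) (wt k')).

Lemma Rmx_block k l :
  mx_block (Rmx pi wt lam Rp) k l =
  Dblock k *m mx_block (\sum_(nu \in @Qplus n) pi_pi pi (Rp nu)) k l.
Proof.
have DE : Dmx pi wt lam = diag_mx (\row_kk' dcoef g lam
    (wt (mxtens_unindex kk').1) (wt (mxtens_unindex kk').2)).
  apply/matrixP => kk' ll'; case: (mxtens_indexP kk') => {kk'} k0 k1.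
  case: (mxtens_indexP ll') => l0 l1; rewrite (Dmx_entry irr) !mxE mxtens_indexK /=.
  by rewrite (can_eq (@mxtens_indexK _ _)) xpair_eqE; case: (_ && _);
    rewrite ?mul1r ?mul0r.
rewrite /Rmx DE; apply/matrixP => k' l'.
by rewrite /Dblock !mul_diag_mx !mxE mxtens_indexK.
Qed.

Lemma Rmx_supp k l : ~ pos_cone g (wt k - wt l) ->
  mx_block (Rmx pi wt lam Rp) k l = 0.
Proof.
move=> nkl; rewrite Rmx_block (_ : mx_block _ k l = 0) ?mulmx0 //.
apply/matrixP => k' l'; rewrite !mxE (fsum_mx_entry0 Rplus_supp) // => nu nu0.
apply/eqP/negPn/negP => /(pi_pi_Rplus_deg nu0) kl; case: nkl.
by exists nu; rewrite // kl addrAC subrr add0r.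
Qed.

Lemma sum_Rplus_block nu k l : Qplus nu -> wt k = wt l + root_weight g nu ->
  mx_block (\sum_(nu \in @Qplus n) pi_pi pi (Rp nu)) k l =
  mx_block (pi_pi pi (Rp nu)) k l.
Proof.
move=> nu0 kl; apply/matrixP => k' l'; rewrite !mxE.
apply: (fsum_mx_entry Rplus_supp) => // nu' nu'0; apply: contraNeq.
move=> /(pi_pi_Rplus_deg nu'0); rewrite kl => /addrI/root_weight_inj ->.
by rewrite eqxx.
Qed.

Lemma Rmx_block0 k l : wt k = wt l ->
  mx_block (Rmx pi wt lam Rp) k l = (k == l)%:R *: Dblock k.
Proof.
move=> kl; rewrite Rmx_block (sum_Rplus_block (nu := 0)) ?root_weight0 ?addr0 //.
  rewrite (Rplus_0 Rplus) (rmorph1 (pi_pi pi)); apply/matrixP => k' l'.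
  rewrite /Dblock mul_diag_mx !mxE (can_eq (@mxtens_indexK _ _)) xpair_eqE.
  by case: (k == l); case: (k' == l'); rewrite /= ?mulr1n ?mulr0n ?mulr1 ?mul1r ?mulr0 ?mul0r.
by move=> i; rewrite mxE.
Qed.

Lemma Rmx_block_sroot i : exists c, forall k l,
  wt k = wt l + root_weight g (sroot i) ->
  mx_block (Rmx pi wt lam Rp) k l =
  pi (Eg g i) k l *: (Dblock k *m (c *: pi (Fg g i))).
Proof.
have [c cE] := pi_pi_Rplus_sroot i; exists c => k l kl.
rewrite Rmx_block (sum_Rplus_block (@Qplus_sroot n i) kl) cE.
apply/matrixP => k' l'.
by rewrite /Dblock !mul_diag_mx !mxE !mxtens_indexK /=; ring.
Qed.

End RMatrix.

(** * Consequences of the RLL relation *)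

(** Intended reading: D is the diagonal part of R; l, Z, E and X are the degree 0 part of L, its
    inverse, E_i and X_i with l, Z, E in the first leg; K, F and L are K_i^-1, c F_i and L in the
    second. The common left factor D l is cancelled. *)
Lemma RLL_cancel (B : pzRingType) (D D' l Z E K X F L : B) :
  D' * D = 1 -> Z * l = 1 -> l * Z = 1 -> l * D = D * l -> E * D = D * E * K ->
  X * D = D * X -> L * E = E * L -> F * l = l * F -> D * l * L = L * l * D ->
  (D * E * F * l + D * l * E * X) * L = L * (l * E * X * D + l * D * E * F) ->
  Z * E * l * F * L + E * X * L = E * L * (K * X + F).
Proof.
move=> D1 Z1 l1 lD ED XD LE Fl DlL RLL.
have D_inj : injective ( *%R (D * l)).
  by apply: (can_inj (g := *%R (Z * D'))) => x; rewrite !mulrA -[Z * D' * D]mulrA D1 mulr1 Z1 mul1r.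
apply: D_inj; transitivity ((D * E * F * l + D * l * E * X) * L).
  rewrite mulrDr mulrDl !mulrA -[D * l * Z]mulrA l1 mulr1.
  by rewrite -[D * E * l * F]mulrA -Fl !mulrA.
rewrite RLL !mulrDr !mulrA; congr +%R.
  rewrite -[L * l * E * X * D]mulrA XD -!mulrA [E * (D * X)]mulrA ED !mulrA.
  by rewrite -DlL -[D * l * E * L]mulrA -LE !mulrA.
by rewrite -DlL -[D * l * E * L]mulrA -LE !mulrA.
Qed.

Lemma mxE_scalarr (R : pzRingType) p (T : 'M[R]_p) x k l :
  (T *m x%:M) k l = T k l * x.
Proof.
rewrite mxE (bigD1 l) //= mxE eqxx mulr1n big1 ?addr0 // => j jl.
by rewrite mxE (negPf jl) mulr0n mulr0.
Qed.

Lemma mxE_scalarl (R : pzRingType) p (T : 'M[R]_p) x k l :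
  (x%:M *m T) k l = x * T k l.
Proof. by rewrite mul_scalar_mx mxE. Qed.

(** * Embedding End(V), U and the base field in End(V) (x) U *)

Section ScalarMatrices.
Variables (U : algType Qq) (N : nat).
Local Notation A := 'M[U]_N.+1.
Implicit Types (M : 'M[Qq]_N.+1) (x : U).

Definition jmx M : A := map_mx (GRing.in_alg U) M.

Lemma jmx_zmod : zmod_morphism jmx.
Proof. exact: (map_mxB (GRing.in_alg U)). Qed.
HB.instance Definition _ := GRing.isZmodMorphism.Build _ _ jmx jmx_zmod.
Lemma jmx_monoid : monoid_morphism jmx.
Proof.
by split=> [|M M']; [exact: (map_mx1 (GRing.in_alg U)) | exact: (map_mxM (GRing.in_alg U))].
Qed.
HB.instance Definition _ := GRing.isMonoidMorphism.Build _ _ jmx jmx_monoid.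

Definition sclmx (c : Qq) : A := (c%:A)%:M.

Lemma sclmx_zmod : zmod_morphism sclmx.
Proof. by move=> c d; rewrite /sclmx scalerBl raddfB. Qed.
HB.instance Definition _ := GRing.isZmodMorphism.Build _ _ sclmx sclmx_zmod.
Lemma sclmx_monoid : monoid_morphism sclmx.
Proof.
split=> [|c d]; first by rewrite /sclmx scale1r.
by rewrite /sclmx -mulmxE -scalar_mxM -(rmorphM (GRing.in_alg U)).
Qed.
HB.instance Definition _ := GRing.isMonoidMorphism.Build _ _ sclmx sclmx_monoid.

Lemma jmxC M x : jmx M * x%:M = x%:M * jmx M.
Proof.
apply/matrixP => k l; rewrite -!mulmxE mxE_scalarr mxE_scalarl !mxE.
by rewrite mulr_algl mulr_algr.
Qed.

Lemma sclmxC c (T : A) : sclmx c * T = T * sclmx c.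
Proof.
apply/matrixP => k l; rewrite -!mulmxE mxE_scalarr mxE_scalarl.
by rewrite mulr_algl mulr_algr.
Qed.

Lemma jmxZ c M : jmx (c *: M) = sclmx c * jmx M.
Proof.
by apply/matrixP => k l; rewrite -!mulmxE mxE_scalarl !mxE -(rmorphM (GRing.in_alg U)).
Qed.

Lemma sclmx_scalar c x : sclmx c * x%:M = (c *: x)%:M.
Proof. by rewrite /sclmx -mulmxE -scalar_mxM mulr_algl. Qed.

End ScalarMatrices.

Lemma comm_cancel (B : pzRingType) (D D' D2 s l : B) :
  D' * D = 1 -> D * s = s * D2 -> D * l = l * D -> D * s * l = l * s * D2 ->
  s * l = l * s.
Proof.
move=> DV Ds Dl eqD; rewrite -[LHS]mul1r -[RHS]mul1r -DV -!mulrA; congr (D' * _).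
by rewrite mulrA eqD -mulrA -Ds mulrA -Dl mulrA.
Qed.

Lemma twist_cancel (B : pzRingType) (D D' D2 s l Z E X c : B) :
  D * D' = 1 -> Z * l = 1 -> D * s = s * D -> D * s = s * D2 -> s * l = l * s ->
  D * l = l * D -> s * E = E * s -> X * D = D * X -> D * E = c * (E * D) ->
  (forall b, c * b = b * c) ->
  D * s * (l * E * X) = l * E * X * s * D2 -> c * (E * (s * X)) = E * (X * s).
Proof.
move=> DV Zl Ds Ds2 sl Dl sE XD DE cC eqD.
have l_inj : injective ( *%R l).
  by apply: (can_inj (g := *%R Z)) => x; rewrite mulrA Zl mul1r.
have D_inj : injective ( *%R^~ D).
  by apply: (can_inj (g := *%R^~ D')) => x; rewrite -mulrA DV mulr1.
apply: l_inj; apply: D_inj; rewrite /=.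
have -> : l * (E * (X * s)) * D = l * E * X * (s * D2) by rewrite -Ds2 Ds !mulrA.
rewrite [RHS]mulrA -eqD -[RHS]mulrA.
have -> : s * (l * E * X) = l * (E * s * X) by rewrite !mulrA sl -[l * s * E]mulrA sE !mulrA.
rewrite [RHS]mulrA Dl -!mulrA; congr (l * _).
by rewrite XD ![RHS]mulrA DE -!mulrA ![s * (D * _)]mulrA -Ds !mulrA.
Qed.

(** Passing Z and l creates K^-1 and K; these cancel except for the constant c that arises when K^-1
    crosses E. *)
Lemma twist_conj (B : pzRingType) (K K' l Z E X c : B) :
  K' * K = 1 -> Z * l = 1 -> l * Z = 1 ->
  X * E = E * X -> K' * E = c * (E * K') -> (forall b, c * b = b * c) ->
  X * l = K * l * X -> X * (Z * E * l) = c * (Z * E * l) * X.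
Proof.
move=> KV Zl lZ XE KE cC Xl.
have XZ : X * Z = Z * K' * X.
  rewrite -[RHS]mulr1 -lZ -[RHS]mulrA [X * (l * Z)]mulrA Xl !mulrA.
  by rewrite -[Z * K' * K]mulrA KV mulr1 Zl mul1r.
rewrite !mulrA XZ -[Z * K' * X * E]mulrA XE -!mulrA Xl !mulrA.
by rewrite -[Z * K' * E]mulrA KE !mulrA -cC -[_ * K' * K]mulrA KV mulr1.
Qed.

Lemma twist_scaled (B : pzRingType) (K Y c F q : B) :
  (forall b, c * b = b * c) -> (forall b, q * b = b * q) ->
  F * Y = Y * F -> K * F = q * (F * K) -> K * Y * (c * F) = q * (c * F * (K * Y)).
Proof.
move=> cC qC FY KF; rewrite [c * F]cC -mulrA [Y * (F * c)]mulrA -FY.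
by rewrite -[F * Y * c]mulrA mulrA KF -[F * c * _]mulrA cC !mulrA.
Qed.

Lemma weight_cancel (B : pzRingType) (K K' l Z s : B) :
  Z * l = 1 -> K * l = l * K -> s * l = l * (K' * s) -> s * l = K * l * s ->
  K * s = K' * s.
Proof.
move=> Zl Kl sl sl'; rewrite -[LHS]mul1r -[RHS]mul1r -Zl -!mulrA; congr (Z * _).
by rewrite -sl sl' Kl mulrA.
Qed.

Lemma RLL_entry (R : pzRingType) m (S T : 'M[R]_m) a b c d (p q : 'I_m) :
  (S *m a%:M *m b%:M + T *m c%:M *m b%:M) p q = (T *m b%:M *m d%:M) p q ->
  S p q * a * b + T p q * c * b = T p q * b * d.
Proof. by rewrite mxE !mxE_scalarr. Qed.

Section RLL.
Variables (n : nat) (g : simple_datum n) (N : nat).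
Variables (pi : {lrmorphism Uq g -> 'M[Qq]_N.+1}) (wt : 'I_N.+1 -> 'rV[int]_n).
Variable lam : 'rV[int]_n.
Hypothesis irr : is_irr_module pi wt lam.
Variables (Delta : {lrmorphism Uq g -> UqUq g}) (Psi : {lrmorphism UqUq g -> UqUq g}).
Variable Rp : 'rV[int]_n -> UqUq g.
Hypothesis Rplus : is_Rplus Delta Psi Rp.

Variable U : algType Qq.
Local Notation A := 'M[U]_N.+1.
Local Notation B := 'M[A]_N.+1.
Variables L Z : A.
Local Notation l0 := (wcomp wt 0 L).
Hypothesis L_supp : wsupp (pos_cone g) wt L.
Hypothesis Zl : Z * l0 = 1.
Hypothesis lZ : l0 * Z = 1.

Local Notation alpha i := (root_weight g (sroot i)).
Local Notation jm := (@jmx U N).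
Local Notation jE i := (jm (pi (Eg g i))).
Local Notation jF i := (jm (pi (Fg g i))).

Definition wdiag (h : 'rV[int]_n -> Qq) : A := jm (diag_mx (\row_k h (wt k))).

Lemma wdiag_twist h c b (T : A) : (forall mu, h (mu + b) = c * h mu) ->
  (forall k l, T k l != 0 -> wt k = wt l + b) ->
  wdiag h * T = sclmx U N c * (T * wdiag h).
Proof.
move=> hb Tb; apply/matrixP => k l; rewrite -!mulmxE mxE_scalarl.
rewrite /wdiag /jmx map_diag_mx mul_diag_mx mul_mx_diag !mxE.
have [->|/Tb ->] := eqVneq (T k l) 0; first by rewrite mul0r !mulr0.
by rewrite hb /= mulr_algl mulr_algr mulr_algl scalerA.
Qed.

Lemma wdiagM h h' : wdiag h * wdiag h' = wdiag (fun mu => h mu * h' mu).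
Proof.
rewrite /wdiag -(rmorphM jm) -mulmxE mulmx_diag; congr (jm (diag_mx _)).
by apply/rowP => k; rewrite !mxE.
Qed.

Lemma wdiag1 h : (forall mu, h mu = 1) -> wdiag h = 1.
Proof.
move=> h1; rewrite /wdiag -(rmorph1 jm) -[1]diag_const_mx; congr (jm (diag_mx _)).
by apply/rowP => k; rewrite !mxE.
Qed.

Lemma wcomp0P (T : A) k l : wcomp wt 0 T = T -> T k l != 0 -> wt k = wt l + 0.
Proof. by move=> <-; rewrite mxE; case: (wt k =P wt l + 0) => // _; rewrite eqxx. Qed.

Lemma wdiagC h (T : A) : wcomp wt 0 T = T -> wdiag h * T = T * wdiag h.
Proof.
move=> T0; rewrite (@wdiag_twist h 1 0) ?rmorph1 ?mul1r //.
  by move=> mu; rewrite addr0 mul1r.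
by move=> k l; apply: wcomp0P.
Qed.

Lemma wdiag_deg0 h : wcomp wt 0 (wdiag h) = wdiag h.
Proof. by rewrite /wdiag /jmx map_diag_mx wcomp0_diag. Qed.

Definition dK b := wdiag (fun mu => qv ^ weight_root_form g mu b).
(** The action of D on the second leg when the first leg is the basis vector k. *)
Definition dD k := wdiag (dcoef g lam (wt k)).

Lemma dDC k (T : A) : wcomp wt 0 T = T -> dD k * T = T * dD k.
Proof. exact: wdiagC. Qed.

Lemma dKC b (T : A) : wcomp wt 0 T = T -> dK b * T = T * dK b.
Proof. exact: wdiagC. Qed.

Lemma dKD b c : dK b * dK c = dK (b + c).
Proof.
rewrite /dK wdiagM; congr wdiag; apply: boolp.funext => mu.
by rewrite -expfzDr ?qv_neq0 // weight_root_formDr.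
Qed.

Lemma dK0 : dK 0 = 1.
Proof. by apply: wdiag1 => mu; rewrite weight_root_form0. Qed.

Lemma dKX b (m : nat) : dK b ^+ m = dK (b *+ m).
Proof.
elim: m => [|m IH]; first by rewrite mulr0n dK0.
by rewrite exprS IH dKD -mulrS.
Qed.

Lemma dDV k : wdiag (fun mu => (dcoef g lam (wt k) mu)^-1) * dD k = 1.
Proof.
rewrite wdiagM; apply: wdiag1 => mu; rewrite mulVf //; exact: dcoef_neq0.
Qed.

Lemma dDVr k : dD k * wdiag (fun mu => (dcoef g lam (wt k) mu)^-1) = 1.
Proof. exact: etrans (dDC k (wdiag_deg0 _)) (dDV k). Qed.

Lemma dK_E i b : dK b * jE i = sclmx U N (qv ^ root_form g (sroot i) b) * (jE i * dK b).
Proof.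
apply: (@wdiag_twist _ _ (alpha i)) => [mu|k l].
  by rewrite weight_root_formDl weight_root_form_root addrC expfzDr ?qv_neq0.
by rewrite mxE fmorph_eq0; apply: (pi_E irr).
Qed.

Lemma dK_F i b : dK b * jF i = sclmx U N (qv ^ (- root_form g (sroot i) b)) * (jF i * dK b).
Proof.
apply: (@wdiag_twist _ _ (- alpha i)) => [mu|k l].
  rewrite -expfzDr ?qv_neq0 //; congr (_ ^ _).
  by rewrite -root_weightN weight_root_formDl weight_root_form_root root_formNl addrC.
by rewrite mxE fmorph_eq0; apply: (pi_F irr).
Qed.

Lemma dD_E k i : dD k * jE i =
  sclmx U N (qv ^ weight_root_form g (wt k) (sroot i)) * (jE i * dD k).
Proof.
apply: (@wdiag_twist _ _ (alpha i)) => [mu|k' l'].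
  by rewrite dcoefDr mulrC.
by rewrite mxE fmorph_eq0; apply: (pi_E irr).
Qed.

(* End(V) (x) End(V) (x) U as matrices over [A = End(V) (x) U], the outer indices
   being those of the first leg: [leg T] is T_1 and [T%:M] is T_2. *)
Definition leg (T : A) : B := map_mx (@scalar_mx U N.+1) T.
Let Rb : B := \matrix_(k, l) jm (mx_block (Rmx pi wt lam Rp) k l).
Hypothesis RLL : Rb * leg L * L%:M = L%:M * leg L * Rb.

Let Db : B := diag_mx (\row_k dD k).

Lemma Rb_supp : wsupp (pos_cone g) wt Rb.
Proof. by move=> k l kl; rewrite mxE (Rmx_supp irr Rplus) // rmorph0. Qed.

Lemma Rb_0 : wcomp wt 0 Rb = Db.
Proof.
apply/matrixP => k l; rewrite !mxE addr0; case: eqP => kl.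
  rewrite (Rmx_block0 irr Rplus) //; case: (k == l); first by rewrite scale1r.
  by rewrite scale0r rmorph0.
by case: (k =P l) kl => [->|].
Qed.

Lemma leg_comp b (T : A) : wcomp wt b (leg T) = leg (wcomp wt b T).
Proof. by apply/matrixP => k l; rewrite !mxE; case: ifP; rewrite ?raddf0. Qed.

Lemma leg_supp : wsupp (pos_cone g) wt (leg L).
Proof. by move=> k l kl; rewrite mxE L_supp // raddf0. Qed.

Lemma alpha_neq0 i : alpha i != 0.
Proof. by apply/eqP => /root_weight_eq0/eqP; apply/negP/sroot_neq0. Qed.

Lemma RLL_0 : Db * leg l0 * L%:M = L%:M * leg l0 * Db.
Proof.
have Cm := @pos_cone_min0 _ g; have sR := Rb_supp; have sL := leg_supp.
rewrite -!mulmxE.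
have <- : wcomp wt 0 (Rb *m leg L *m L%:M) = Db *m leg l0 *m L%:M.
  by rewrite wcompM_0r ?wcomp0_scalar // (wcompM0 Cm) // Rb_0 leg_comp.
have <- : wcomp wt 0 (L%:M *m leg L *m Rb) = L%:M *m leg l0 *m Db.
  by rewrite -mulmxA wcompM_0l ?wcomp0_scalar // (wcompM0 Cm) // Rb_0 leg_comp mulmxA.
by rewrite !mulmxE RLL.
Qed.

Lemma RLL_0_entry k l : dD k * (l0 k l)%:M * L = L * (l0 k l)%:M * dD l.
Proof.
have /matrixP/(_ k l) := RLL_0; rewrite -!mulmxE mxE_scalarr mul_mx_diag mxE.
by rewrite mxE_scalarl mul_diag_mx !mxE.
Qed.

Lemma scalar_mx0E : (0 : U)%:M = 0 :> A.
Proof. by apply/matrixP => k l; rewrite !mxE mul0rn. Qed.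

Lemma dD_eq k l (x : U) : (wt k != wt l -> x = 0) -> dD k * x%:M = x%:M * dD l.
Proof.
rewrite jmxC => x0; have [kl|/x0 ->] := eqVneq (wt k) (wt l).
  by rewrite /dD kl.
by move: (dD k) (dD l) => D D'; rewrite scalar_mx0E !mul0r.
Qed.

Lemma dD_l0 k l : dD k * (l0 k l)%:M = (l0 k l)%:M * dD l.
Proof. by apply: dD_eq => kl; rewrite mxE addr0 (negPf kl). Qed.

(** Degree 0 of the RLL relation in both legs: there the two diagonal factors agree and cancel. *)
Lemma l0_comm k l : (l0 k l)%:M * l0 = l0 * (l0 k l)%:M.
Proof.
have s0 : wcomp wt 0 (l0 k l)%:M = (l0 k l)%:M by rewrite wcomp0_scalar.
have dDs k' : wcomp wt 0 (dD k' *m (l0 k l)%:M) = dD k' *m (l0 k l)%:M.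
  by rewrite wcompM_0l ?s0 //; exact: wdiag_deg0.
have sdD k' : wcomp wt 0 ((l0 k l)%:M *m dD k') = (l0 k l)%:M *m dD k'.
  by rewrite !mulmxE -jmxC -mulmxE; exact: dDs.
have Dl : dD k * (l0 k l)%:M * l0 = l0 * (l0 k l)%:M * dD l.
  rewrite -!mulmxE -(wcompM_0l L 0 (dDs k)) -mulmxA -(wcompM_0r L 0 (sdD l)).
  by rewrite mulmxA !mulmxE RLL_0_entry.
exact: comm_cancel (dDV k) (dD_l0 k l) (dDC _ (wcomp0_idem _ _)) Dl.
Qed.

Hypothesis lam_neq0 : lam != 0.

Section Generator.
Variables (i : 'I_n) (X : U).
Hypothesis X_i : wcomp wt (alpha i) (Z * L) = jE i * X%:M.

Lemma L_alpha : wcomp wt (alpha i) L = l0 * jE i * X%:M.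
Proof.
rewrite -mulrA -X_i -mulmxE -wcompM_0l ?wcomp0_idem // mulmxA.
by rewrite [l0 *m Z]lZ mul1mx.
Qed.

(* Degree 0 in the first leg and alpha_i in the second. *)
Lemma X_l0 : X%:M * l0 = dK (sroot i) * l0 * X%:M.
Proof.
have [p [q Epq]] : exists p q, pi (Eg g i) p q != 0.
  by have /matrix0Pn [p [q Epq]] := pi_E_neq0 irr i lam_neq0; exists p, q.
have la : wcomp wt (alpha i) L = l0 * jE i * X%:M := L_alpha.
suff H k l : X * l0 k l =
    qv ^ weight_root_form g (wt k) (sroot i) *: (l0 k l * X).
  apply/matrixP => k l; rewrite -!mulmxE mxE_scalarr mxE_scalarl H.
  rewrite mulmxE /dK /wdiag /jmx map_diag_mx -mulmxE mul_diag_mx !mxE.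
  by rewrite mulr_algl scalerAl.
set s := l0 k l; have lD := l0_comm k l; have sD := dD_l0 k l.
have s0 : wcomp wt 0 (s%:M : A) = s%:M by rewrite wcomp0_scalar.
have dDs k' : wcomp wt 0 (dD k' *m s%:M) = dD k' *m s%:M.
  by rewrite wcompM_0l ?s0 //; exact: wdiag_deg0.
have sdD k' : wcomp wt 0 (s%:M *m dD k') = s%:M *m dD k'.
  by rewrite !mulmxE -jmxC -mulmxE; exact: dDs.
have Dl : dD k * s%:M * (l0 * jE i * X%:M) = l0 * jE i * X%:M * s%:M * dD l.
  rewrite -la -!mulmxE -(wcompM_0l L _ (dDs k)) -[RHS]mulmxA -(wcompM_0r L _ (sdD l)).
  by rewrite mulmxA !mulmxE RLL_0_entry.
have := twist_cancel (dDVr k) Zl (jmxC _ _) sD lD (dDC _ (wcomp0_idem _ _)) (esym (jmxC _ _))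
  (esym (jmxC _ _)) (dD_E _ _) (@sclmxC _ _ _) Dl.
(* Both sides carry the factor E_i, which is removed at an entry where it does not vanish. *)
rewrite -!mulmxE -!scalar_mxM => /matrixP/(_ p q).
have jEpq : jE i p q = (pi (Eg g i) p q)%:A by rewrite mxE.
rewrite mxE_scalarl !mxE_scalarr jEpq !mulr_algl scalerA [_ * pi _ p q]mulrC -scalerA.
by move/(scalerI Epq).
Qed.

Lemma legM (S T : A) : leg (S * T) = leg S * leg T.
Proof. exact: (map_mxM (@scalar_mx U N.+1)). Qed.

Lemma leg_one : leg 1 = 1.
Proof. exact: (map_mx1 (@scalar_mx U N.+1)). Qed.

Lemma leg_scalar (x : U) : leg x%:M = (x%:M)%:M.
Proof. exact: (map_scalar_mx (@scalar_mx U N.+1)). Qed.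

Lemma leg_jm M k l : leg (jm M) k l = sclmx U N (M k l).
Proof. by rewrite !mxE. Qed.

Lemma leg_Db (T : A) : wcomp wt 0 T = T -> leg T * Db = Db * leg T.
Proof.
move=> T0; apply/matrixP => k l; rewrite -!mulmxE mul_mx_diag mul_diag_mx !mxE.
by apply/esym/dD_eq => kl; rewrite -T0 mxE addr0 (negPf kl).
Qed.

Lemma leg_scalarC (c : A) (T : A) : (forall k l, c * (T k l)%:M = (T k l)%:M * c) ->
  c%:M * leg T = leg T * c%:M.
Proof.
by move=> cT; apply/matrixP => k l; rewrite -!mulmxE mxE_scalarr mxE_scalarl !mxE.
Qed.

(** The exponent of D is bilinear in the two weights up to a constant, so moving the first by
    alpha_i acts on the second leg as K_i. *)
Lemma dD_V_E k l : wt k = wt l + alpha i -> dD l = dD k * dK (- sroot i).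
Proof.
move=> kl; rewrite /dD /dK wdiagM; congr wdiag; apply: boolp.funext => mu.
rewrite kl ![dcoef _ _ _ mu]dcoefC dcoefDr weight_root_formNr.
by rewrite -mulrA -expfzDr ?qv_neq0 // subrr mulr1.
Qed.

Lemma leg_E_Db : leg (jE i) * Db = Db * leg (jE i) * (dK (- sroot i))%:M.
Proof.
apply/matrixP => k l; rewrite -!mulmxE mxE_scalarr mul_mx_diag mul_diag_mx.
rewrite [LHS]mxE [in RHS]mxE leg_jm !mxE.
have [->|/(pi_E irr) /dD_V_E ->] := eqVneq (pi (Eg g i) k l) 0.
  by rewrite raddf0; move: (dD k) (dD l) (dK _) => a b c; rewrite mulr0 !mul0r.
by rewrite -sclmxC !mulrA sclmxC.
Qed.

Lemma Rb_alpha : exists c, wcomp wt (alpha i) Rb =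
  Db * leg (jE i) * (jm (c *: pi (Fg g i)))%:M.
Proof.
have [c cE] := Rmx_block_sroot irr Rplus i; exists c.
apply/matrixP => k l; rewrite -!mulmxE mxE_scalarr mul_diag_mx [LHS]mxE.
rewrite [in RHS]mxE leg_jm !mxE; case: eqP => [/cE ->|nkl].
  by rewrite jmxZ -mulmxE (rmorphM jm) mulmxE mulrA -sclmxC.
have -> : pi (Eg g i) k l = 0 by apply/eqP/negPn/negP => /(pi_E irr).
by rewrite raddf0; move: (dD k) (jm _) => a b; rewrite mulr0 mul0r.
Qed.

(* Degree alpha_i in the first leg: [L] intertwines two coproducts of F_i. The matrix
   (l^-1 E_i l) / E_i is read off at one entry (p, q) where E_i does not vanish; c is the
   unknown coefficient of E_i (x) F_i in R. *)
Lemma RLL_alpha : exists c p q e, [/\ pi (Eg g i) p q = e, e != 0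
  & (X%:M + ((c * e^-1) *: (Z * jE i * l0) p q)%:M * jF i) * L =
    L * (dK (- sroot i) * X%:M + sclmx U N c * jF i)].
Proof.
have [p [q Epq]] : exists p q, pi (Eg g i) p q != 0.
  by have /matrix0Pn [p [q Epq]] := pi_E_neq0 irr i lam_neq0; exists p, q.
have [c Ra] := Rb_alpha; exists c, p, q, (pi (Eg g i) p q); split=> //.
have La : wcomp wt (alpha i) (leg L) = leg l0 * leg (jE i) * (X%:M)%:M.
  by rewrite leg_comp L_alpha !legM leg_scalar.
set F2 := (jm _)%:M in Ra.
have eqa : (Db * leg (jE i) * F2 * leg l0 + Db * leg l0 * leg (jE i) * (X%:M)%:M) * L%:M =
  L%:M * (leg l0 * leg (jE i) * (X%:M)%:M * Db + leg l0 * Db * leg (jE i) * F2).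
  have Ca := @pos_cone_min_sroot _ g i; have sR := Rb_supp; have sL := leg_supp.
  have a0 := alpha_neq0 i.
  transitivity (wcomp wt (alpha i) (Rb *m leg L *m L%:M)).
    rewrite wcompM_0r ?wcomp0_scalar // (wcompM a0 Ca sR sL) Rb_0 (leg_comp 0) Ra La.
    by rewrite !mulmxE !mulrA.
  rewrite [_ *m _]RLL -mulrA -!mulmxE wcompM_0l ?wcomp0_scalar //.
  by rewrite (wcompM a0 Ca sL sR) Rb_0 (leg_comp 0) Ra La !mulmxE !mulrA.
have DbV : diag_mx (\row_k wdiag (fun mu => (dcoef g lam (wt k) mu)^-1)) * Db = 1.
  rewrite -mulmxE mulmx_diag -[1]diag_const_mx; congr diag_mx.
  by apply/rowP => k; rewrite !mxE dDV.
have legZl : leg Z * leg l0 = 1 by rewrite -legM Zl leg_one.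
have leglZ : leg l0 * leg Z = 1 by rewrite -legM lZ leg_one.
have XD : (X%:M)%:M * Db = Db * (X%:M)%:M by rewrite -leg_scalar leg_Db ?wcomp0_scalar.
have LE : L%:M * leg (jE i) = leg (jE i) * L%:M.
  by apply: leg_scalarC => k l; rewrite !mxE; exact/esym/sclmxC.
have Fl : F2 * leg l0 = leg l0 * F2 by apply: leg_scalarC => k l; rewrite jmxC.
have := RLL_cancel DbV legZl leglZ (leg_Db (wcomp0_idem _ _)) leg_E_Db XD LE Fl RLL_0 eqa.
rewrite -!legM => /matrixP/(_ p q).
set G := Z * _ * l0; set e := pi _ p q in Epq *.
have -> : (dK (- sroot i))%:M * (X%:M)%:M + F2 =
    (dK (- sroot i) * X%:M + sclmx U N c * jF i)%:M :> B.
  by rewrite raddfD /F2 jmxZ; congr (_ + _); exact/esym/scalar_mxM.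
have legGpq : leg G p q = (G p q)%:M by rewrite mxE.
(* What remains is to divide the entry (p, q) by e, which turns the coefficient of X into 1. *)
move/RLL_entry; rewrite (leg_jm (pi (Eg g i)) p q) -/e legGpq jmxZ.
move: (dK _) (jF i) => K F eqe.
have e1 : sclmx U N e^-1 * sclmx U N e = 1 by rewrite -rmorphM mulVf // rmorph1.
have -> : ((c / e) *: G p q)%:M = sclmx U N e^-1 * ((G p q)%:M * sclmx U N c).
  by rewrite -sclmx_scalar -sclmxC mulrA -rmorphM mulrC [e^-1 * c]mulrC.
rewrite -[X%:M in LHS]mul1r -e1 -[sclmx U N e^-1 * _ * X%:M]mulrA.
rewrite -[sclmx U N e^-1 * _ * F]mulrA -mulrDr addrC -mulrA mulrDl.
by rewrite -[(G p q)%:M * _ * F]mulrA eqe !mulrA e1 mul1r.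
Qed.

End Generator.

(** This twist makes the multiples k_i F_i q-commute with X_j, although F_i itself commutes with
    X_j. *)
Lemma conj_X i j (X : U) : X%:M * l0 = dK (sroot j) * l0 * X%:M ->
  X%:M * (Z * jE i * l0) =
  sclmx U N (qv ^ (- root_form g (sroot i) (sroot j))) * (Z * jE i * l0) * X%:M.
Proof.
move=> Xl; apply: (twist_conj (K := dK (sroot j)) (K' := dK (- sroot j))) => //.
- by rewrite dKD addrC subrr dK0.
- exact/esym/jmxC.
- by rewrite dK_E root_formC root_formNl root_formC.
- exact: sclmxC.
Qed.

(** Entries of l0 commute with each other, hence with those of its inverse and of the conjugates.
    Applying the same closure argument to an entry of a conjugate gives the claim. *)
Lemma conj_conj i j p q p' q' :
  GRing.comm ((Z * jE i * l0) p q) ((Z * jE j * l0) p' q').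
Proof.
pose cm (x : U) (T : A) := x%:M * T = T * x%:M.
have cmP x T : cm x T <-> forall k l, x * T k l = T k l * x.
  split=> [/matrixP xT k l|xT].
    by have := xT k l; rewrite -!mulmxE mxE_scalarr mxE_scalarl.
  by apply/matrixP => k l; rewrite -!mulmxE mxE_scalarr mxE_scalarl.
have cmE x k : cm x (jE k) by rewrite /cm jmxC.
have cmM x S T : cm x S -> cm x T -> cm x (S * T).
  by rewrite /cm => xS xT; rewrite mulrA xS -mulrA xT mulrA.
have cmV x : cm x l0 -> cm x Z.
  rewrite /cm => xl; rewrite -[LHS]mul1r -[in LHS]Zl -[LHS]mulrA.
  rewrite -[in RHS](mulr1 (x%:M)) -lZ [in RHS](mulrA x%:M) xl !mulrA Zl !mul1r.
  by [].
have cmG x k : cm x l0 -> cm x (Z * jE k * l0).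
  by move=> xl; apply: (cmM) => //; apply: (cmM) => //; apply: cmV.
have l0G k' l' k : cm (l0 k' l') (Z * jE k * l0) by apply/cmG/l0_comm.
have Gl0 k' l' k : cm ((Z * jE k * l0) k' l') l0.
  by apply/cmP => k0 l1; apply/esym; move: k' l'; apply/cmP.
by move: p' q'; apply/cmP/cmG/Gl0.
Qed.

Lemma gserre_jF i j : i != j ->
  gserre (sclmx U N) (qi g i) (serre_deg g i j) (jF i) (jF j) = 0.
Proof.
move=> ij; have piS : qserre (qi g i) (serre_deg g i j) (pi (Fg g i)) (pi (Fg g j)) = 0.
  by rewrite -(rmorph_qserre pi) (Uq_serre_F g ij) rmorph0.
by rewrite -(qserre_rmorph _ _ _ _ (@jmxZ U N)) piS rmorph0.
Qed.

Lemma gserre_scalar v m (X Y : U) :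
  gserre (sclmx U N) v m X%:M Y%:M = (qserre v m X Y)%:M.
Proof.
have sZ c (z : U) : (c *: z)%:M = sclmx U N c * z%:M by rewrite sclmx_scalar.
by rewrite (qserre_rmorph v m X Y sZ).
Qed.

Lemma qi_serre_deg i j : i != j ->
  qv ^ root_form g (sroot i) (sroot j) * qi g i ^+ serre_deg g i j = qi g i.
Proof.
move=> ij; have rf : root_form g (sroot i) (sroot j) = cartan g i j * (dlen g i)%:Z.
  rewrite root_formC -weight_root_form_root weight_root_form_sroot; congr (_ * _).
  rewrite mxE (bigD1 j) //= big1 => [|k kj]; last by rewrite mxE (negPf kj) mulr0.
  by rewrite mxE !eqxx mulr1 addr0.
(* Off the diagonal a_ij <= 0, so the absolute value in [serre_deg] has no effect. *)
have mE : (serre_deg g i j)%:Z = 1 - cartan g i j.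
  by rewrite /serre_deg gez0_abs // subr_ge0 (le_trans (cartan_le0 g ij)).
rewrite rf /qi -exprM [qv ^+ (_ * _)]exprnP [RHS]exprnP -expfzDr ?qv_neq0 //.
congr (_ ^ _).
by rewrite PoszM mE; ring.
Qed.

Lemma qi_sqr i : qi g i ^+ 2 = qv ^ root_form g (sroot i) (sroot i).
Proof.
have -> : root_form g (sroot i) (sroot i) = 2 * (dlen g i)%:Z.
  rewrite -weight_root_form_root weight_root_form_sroot; congr (_ * _).
  rewrite mxE (bigD1 i) //= big1 => [|k kj]; last by rewrite mxE (negPf kj) mulr0.
  by rewrite mxE !eqxx mulr1 addr0 cartan_diag.
by rewrite /qi -exprM exprnP mulnC PoszM.
Qed.

Theorem serre_RLL i j (Xi Xj : U) : i != j ->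
  wcomp wt (alpha i) (Z * L) = jE i * Xi%:M ->
  wcomp wt (alpha j) (Z * L) = jE j * Xj%:M ->
  qserre (qi g i) (serre_deg g i j) Xi Xj = 0.
Proof.
move=> ij Xi_i Xj_j; set v := qi g i; set m := serre_deg g i j.
have v0 : v != 0 := qi_neq0 g i.
have v_gen (k : nat) : v ^+ k = 1 -> k = 0%N by apply: qi_generic.
have ioC c (T : A) : sclmx U N c * T = T * sclmx U N c := sclmxC c T.
have pv : qv ^ root_form g (sroot i) (sroot j) * v ^+ m = v := qi_serre_deg ij.
have Xil := X_l0 Xi_i; have Xjl := X_l0 Xj_j.
have [ci [p [q [e [_ _ ai]]]]] := RLL_alpha Xi_i.
have [cj [p' [q' [e' [_ _ aj]]]]] := RLL_alpha Xj_j.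
set s := qserre v m Xi Xj.
set ki := _ *: _ in ai; set kj := _ *: _ in aj.
have kX k (c : Qq) r r' l (Y : U) : Y%:M * l0 = dK (sroot l) * l0 * Y%:M ->
    (c *: (Z * jE k * l0) r r')%:M * jF k * Y%:M =
    sclmx U N (qv ^ root_form g (sroot k) (sroot l))
      * (Y%:M * ((c *: (Z * jE k * l0) r r')%:M * jF k)) :> A.
  set G := _ r r' => Yl.
  have YG : Y * G = qv ^ (- root_form g (sroot k) (sroot l)) *: (G * Y).
    have /matrixP/(_ r r') := conj_X k Yl.
    by rewrite -!mulmxE mxE_scalarl mxE_scalarr mxE_scalarl !mulmxE mulr_algl scalerAl.
  have GY : (c *: G) * Y = qv ^ root_form g (sroot k) (sroot l) *: (Y * (c *: G)).
    rewrite -scalerAr YG -scalerAl !scalerA; congr (_ *: _).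
    by rewrite mulrAC -expfzDr ?qv_neq0 // subrr mul1r.
  have GYM : (c *: G)%:M * Y%:M = sclmx U N (qv ^ root_form g (sroot k) (sroot l))
      * (Y%:M * (c *: G)%:M) :> A.
    by rewrite -[Y%:M * _]scalar_mxM sclmx_scalar -GY -[LHS]scalar_mxM.
  by rewrite -mulrA jmxC mulrA GYM -!mulrA.
have kk : ki * kj = kj * ki.
  have scC (a b : Qq) (x y : U) : x * y = y * x -> (a *: x) * (b *: y) = (b *: y) * (a *: x).
    by move=> xy; rewrite -!scalerAl -!scalerAr !scalerA [a * b]mulrC xy.
  by apply: scC; exact: conj_conj.
have kkM : ki%:M * kj%:M = kj%:M * ki%:M :> A.
  by rewrite -!mulmxE -!scalar_mxM kk.
(* Left side of the intertwining relation: the F part contributes a multiple of S(F_i, F_j) = 0. *)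
have Sa : gserre (sclmx U N) v m (Xi%:M + ki%:M * jF i) (Xj%:M + kj%:M * jF j) = s%:M.
  rewrite (gserre_skew (p := qv ^ root_form g (sroot i) (sroot j)) ioC) //; first last.
  - by rewrite root_formC; apply: kX.
  - exact: kX.
  - by rewrite qi_sqr; apply: kX.
  have kF k l : GRing.comm (k%:M : A) (jF l) by exact/esym/jmxC.
  rewrite (gserre_scale ioC v m (kF _ _) (kF _ _) (kF _ _) kkM) gserre_jF // mulr0 addr0.
  exact: gserre_scalar.
have KX k l c (Y : U) : dK (- sroot k) * Y%:M * (sclmx U N c * jF l) =
    sclmx U N (qv ^ root_form g (sroot k) (sroot l))
      * (sclmx U N c * jF l * (dK (- sroot k) * Y%:M)).
  apply: (twist_scaled (ioC c) (ioC _) (jmxC _ _)).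
  by rewrite dK_F [root_form _ _ (- _)]root_formC root_formNl opprK.
have Sb : gserre (sclmx U N) v m (dK (- sroot i) * Xi%:M + sclmx U N ci * jF i)
    (dK (- sroot j) * Xj%:M + sclmx U N cj * jF j) =
    dK (- sroot i *+ m - sroot j) * s%:M.
  (* The order of the summands is reversed: here K^-1 X is the one that q-commutes past F with a
     positive power. *)
  rewrite addrC [_ + sclmx U N cj * _]addrC.
  rewrite (gserre_skew (p := qv ^ root_form g (sroot i) (sroot j)) ioC) //; first last.
  - by rewrite root_formC; apply: KX.
  - exact: KX.
  - by rewrite qi_sqr; apply: KX.
  have cF (c : Qq) (T : A) : GRing.comm (sclmx U N c) T by exact: ioC.
  rewrite (gserre_scale ioC v m (cF _ _) (cF _ _) (cF _ _) (cF _ _)) gserre_jF // mulr0 add0r.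
  have KC b (x : U) : GRing.comm (dK b) x%:M by exact: jmxC.
  have KK b c : GRing.comm (dK b) (dK c) by rewrite /GRing.comm !dKD addrC.
  by rewrite (gserre_scale ioC v m (KC _ _) (KC _ _) (KC _ _) (KK _ _)) gserre_scalar dKX dKD.
have sL : s%:M * L = L * (dK (- sroot i *+ m - sroot j) * s%:M).
  exact: etrans (congr1 (fun T => T * L) (esym Sa))
    (etrans (gserre_intertwine ioC v m ai aj) (congr1 (fun T => L * T) Sb)).
(* The factors around L have degree 0, so the relation descends to the degree 0 part of L. *)
have sl : s%:M * l0 = l0 * (dK (- sroot i *+ m - sroot j) * s%:M).
  have s0 : wcomp wt 0 (s%:M : A) = s%:M := wcomp0_scalar _ _.
  have Ks0 : wcomp wt 0 (dK (- sroot i *+ m - sroot j) *m s%:M) =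
      dK (- sroot i *+ m - sroot j) *m s%:M.
    by rewrite wcompM_0l ?s0 //; exact: wdiag_deg0.
  rewrite -!mulmxE -(wcompM_0l L 0 s0) -(wcompM_0r L 0 Ks0).
  by congr (wcomp wt 0 _).
have tw : s%:M * l0 = dK (sroot i *+ m + sroot j) * l0 * s%:M.
  have KC b (x : U) : GRing.comm (dK b) x%:M by exact: jmxC.
  have KK b c : GRing.comm (dK b) (dK c) by rewrite /GRing.comm !dKD addrC.
  have := gserre_twist ioC v m (KC _ _) (KC _ _) (KC _ _) (KK _ _) Xil Xjl.
  by rewrite gserre_scalar dKX dKD.
have [k wk] := exists_weight irr lam_neq0 ij m.
have Ks : dK (sroot i *+ m + sroot j) * s%:M = dK (- sroot i *+ m - sroot j) * s%:M.
  exact: weight_cancel Zl (dKC _ (wcomp0_idem _ _)) sl tw.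
have dKs b : (dK b * s%:M) k k = qv ^ weight_root_form g (wt k) b *: s.
  by rewrite -mulmxE mxE_scalarr /dK /wdiag /jmx map_diag_mx !mxE eqxx mulr1n mulr_algl.
have /matrixP/(_ k k) := Ks; rewrite !dKs => /eqP; rewrite -subr_eq0 -scalerBl scaler_eq0.
(* Otherwise q^(wt k, theta) equals its inverse, which forces (wt k, theta) = 0 and contradicts the
   choice of k. *)
case/orP => [|/eqP //]; rewrite subr_eq0 => /eqP /qv_expz_inj/eqP.
rewrite mulNrn -opprD weight_root_formNr -subr_eq0 opprK -mulr2n mulrn_eq0 /=.
by rewrite (negPf wk).
Qed.

End RLL.

(** * The RLL relation of the algebra [UR] *)

Section Blocks.
Variables (N : nat) (U : nzRingType).
Local Notation A := 'M[U]_N.+1.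
Implicit Types (S T : 'M[U]_(N.+1 * N.+1)) (M : A).

(** Passage from the Kronecker indexing of the algebra's presentation to matrices over matrices,
    multiplicative by [blocksM]. *)
Definition blocks T : 'M[A]_N.+1 := \matrix_(k, l) mx_block T k l.

Lemma blocksM S T : blocks (S *m T) = blocks S *m blocks T.
Proof.
apply/matrixP => k l; apply/matrixP => k' l'; rewrite !mxE summxE.
transitivity (\sum_p \sum_p' S (mxtens_index (k, k')) (mxtens_index (p, p')) *
    T (mxtens_index (p, p')) (mxtens_index (l, l'))).
  rewrite pair_big /= (reindex (@mxtens_index N.+1 N.+1)) /=.
    by apply: eq_bigr => -[p p'].
  exists (@mxtens_unindex N.+1 N.+1) => x _; first exact: mxtens_indexK.
  exact: mxtens_unindexK.
apply: eq_bigr => p _; rewrite !mxE; apply: eq_bigr => p' _.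
by rewrite !mxE.
Qed.

Lemma blocks_leg1 M : blocks (leg1 M) = map_mx (@scalar_mx U N.+1) M.
Proof.
apply/matrixP => k l; apply/matrixP => k' l'.
by rewrite !mxE !mxtens_indexK /= mulr_natr.
Qed.

Lemma blocks_leg2 M : blocks (leg2 M) = M%:M.
Proof.
apply/matrixP => k l; apply/matrixP => k' l'.
rewrite !mxE !mxtens_indexK /=; case: (k == l); first by rewrite mul1r mulr1n.
by rewrite mul0r mulr0n mxE.
Qed.

End Blocks.

Lemma blocks_in_alg (U : algType Qq) N (R : 'M[Qq]_(N.+1 * N.+1)) :
  blocks (map_mx (GRing.in_alg U) R) = \matrix_(k, l) jmx U (mx_block R k l).
Proof. by apply/matrixP => k l; apply/matrixP => k' l'; rewrite !mxE. Qed.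

Section URRelations.
Variables (n : nat) (g : simple_datum n) (N : nat).
Variables (wt : 'I_N.+1 -> 'rV[int]_n) (R : 'M[Qq]_(N.+1 * N.+1)).
Local Notation U := (UR g wt R).
Local Notation free := (free_alg Qq (UR_gens N)).
Local Notation L := (Lmx g wt R).

Let h : {lrmorphism free -> U} := quot_pi (Relators (@UR_proper n g N wt R)).

Let h_rel x : UR_rel g wt R x -> h x = 0.
Proof. by move=> Rx; apply: quot_pi0; apply: ideal_gen. Qed.

Let h_eq p (S T : 'M[free]_p) :
  (forall k l, UR_rel g wt R ((S - T) k l)) -> map_mx h S = map_mx h T.
Proof.
move=> ST; apply/matrixP => k l; rewrite [LHS]mxE [RHS]mxE.
apply/eqP; rewrite -subr_eq0 -rmorphB; apply/eqP.
by have := h_rel (ST k l); rewrite !mxE.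
Qed.

Lemma UR_supp : wsupp (pos_cone g) wt (L true).
Proof.
move=> k l kl; rewrite mxE; apply: h_rel; apply: UR_deg.
by move=> [b b0 kl_b]; apply: kl; exists b.
Qed.

Lemma UR_deg0_inv s :
  deg_comp g wt 0 (L s) * deg_comp g wt 0 (L (~~ s)) = 1 :> 'M[U]_N.+1.
Proof.
have hL0 s' : map_mx h (deg_comp g wt 0 (fL N s')) = deg_comp g wt 0 (L s').
  by apply/matrixP => k l; rewrite !mxE; case: ifP; rewrite ?rmorph0.
have := h_eq (fun k l => UR_inv g wt R s k l).
by rewrite map_mxM map_mx1 !hL0.
Qed.

Lemma UR_RLL_mx : map_mx (GRing.in_alg U) R *m leg1 (L true) *m leg2 (L true) =
  leg2 (L true) *m leg1 (L true) *m map_mx (GRing.in_alg U) R.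
Proof.
have hR : map_mx h (map_mx (GRing.in_alg free) R) = map_mx (GRing.in_alg U) R.
  by apply/matrixP => k l; rewrite !mxE (rmorph_alg h).
have h1 : map_mx h (leg1 (fL N true)) = leg1 (L true).
  by rewrite /leg1 map_mxT map_mx1.
have h2 : map_mx h (leg2 (fL N true)) = leg2 (L true).
  by rewrite /leg2 map_mxT map_mx1.
have := h_eq (fun k l => UR_RLL g wt R true k l).
by rewrite !map_mxM hR h1 h2.
Qed.

End URRelations.

Theorem corollary5p6 (n : nat) (g : simple_datum n) (lam : 'rV[int]_n)
  (N : nat) (pi : {lrmorphism Uq g -> 'M[Qq]_N.+1})
  (wt : 'I_N.+1 -> 'rV[int]_n)
  (Delta : {lrmorphism Uq g -> UqUq g})
  (Psi : {lrmorphism UqUq g -> UqUq g})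
  (Rp : 'rV[int]_n -> UqUq g)
  (i j : 'I_n)
  (Xi Xj : UR g wt (Rmx pi wt lam Rp)) :
  dominant lam -> lam != 0 ->
  is_irr_module pi wt lam ->
  is_coproduct Delta -> is_Psi Psi -> is_Rplus Delta Psi Rp ->
  i != j ->
  is_X pi i Xi -> is_X pi j Xj ->
  qserre (qi g i) (serre_deg g i j) Xi Xj = 0.
Proof.
move=> _ lam0 irr _ _ Rplus ij Xi_i Xj_j.
have deg0E s : deg_comp g wt 0 (Lmx g wt (Rmx pi wt lam Rp) s) =
    wcomp wt 0 (Lmx g wt (Rmx pi wt lam Rp) s).
  by rewrite /deg_comp root_weight0.
have XE k (X : UR g wt (Rmx pi wt lam Rp)) :
    \matrix_(p, q) (pi (Eg g k) p q *: X) = jmx _ (pi (Eg g k)) * X%:M.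
  by apply/matrixP => p q; rewrite -mulmxE mxE_scalarr !mxE mulr_algl.
(* The degree 0 part of L^- serves as the two-sided inverse of that of L^+. *)
have lZ := UR_deg0_inv g wt (Rmx pi wt lam Rp) true.
have Zl := UR_deg0_inv g wt (Rmx pi wt lam Rp) false.
have RLL := congr1 (@blocks _ _) (UR_RLL_mx g wt (Rmx pi wt lam Rp)).
rewrite !blocksM blocks_leg1 blocks_leg2 blocks_in_alg in RLL.
rewrite /is_X XE in Xi_i; rewrite /is_X XE in Xj_j.
rewrite /= !deg0E in lZ Zl Xi_i Xj_j.
exact: (serre_RLL irr Rplus (@UR_supp _ _ _ _ _) Zl lZ RLL lam0 ij Xi_i Xj_j).
Qed.
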